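(* Let $\mathcal{X}=\{\mathbf{x}_1,\ldots,\mathbf{x}_K\}\subseteq\mathbb{R}^d$ be a finite set of experiments spanning $\mathbb{R}^d$, and let $L=\max_{\mathbf{x}\in\mathcal{X}}\|\mathbf{x}\|^2$. Let $0<\delta<1$. (E-optimal design.) Let $\mu_E^\star\in\Delta_K$ be a solution of the relaxed E-optimal design problem, and let $n$ be a positive integer with $$n > 2L\,\big\|\mathbf{M}(\mu_E^\star)^{-1}\big\|\,\log(d/\delta).$$ Let $\mathbf{S}_{E,n}$ be the sum of $n$ i.i.d. random matrices drawn from $\mu_E^\star$. Then, with probability at least $1-\delta$, $$f_E\big(\mathbf{S}_{E,n}^{-1}\big)\le\left(1+\frac{1}{\sqrt{\dfrac{n}{2L\|\mathbf{M}(\mu_E^\star)^{-1}\|\log(d/\delta)}}-1}\right)f_{E,n}^\star .$$ (G-optimal design.) Let $\mu_G^\star\in\Delta_K$ be a solution of the relaxed G-optimal design problem, let $\mathbf{S}_{G,n}$ be the sum of $n$ i.i.d. random matrices drawn from $\mu_G^\star$, and let $\sigma^2=L^2\sum_{k=1}^K[\mu_G^\star]_k(1-[\mu_G^\star]_k)$. Then there is a deterministic real sequence $(r_n)_n$ with $r_n=o(1/\sqrt{n})$ as $n\to\infty$ (with $\mathcal{X}$, $\mu_G^\star$ and $\delta$ fixed) such that, for all sufficiently large $n$, with probability at least $1-2\delta$, $$f_G\big(\mathbf{S}_{G,n}^{-1}\big)\le\left(1+\frac{L}{d}\,\|\mathbf{M}(\mu_G^\star)^{-1}\|^2\sqrt{\frac{2\sigma^2}{n}\log(d/\delta)}+r_n\right)f_{G,n}^\star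 .$$
   Context: $\|\cdot\|$ is the Euclidean norm for vectors and the spectral (operator) norm for matrices. $\Delta_K=\{\mu\in[0,1]^K:\sum_{k=1}^K[\mu]_k=1\}$, where $[\mu]_k$ is the $k$-th coordinate of $\mu$. For $\mu\in\Delta_K$, $\mathbf{M}(\mu)=\sum_{k=1}^K[\mu]_k\,\mathbf{x}_k\mathbf{x}_k^\top$. For a $d\times d$ positive semidefinite matrix $\mathbf{A}$, $f_E(\mathbf{A})=\|\mathbf{A}\|$ and $f_G(\mathbf{A})=\max_{\mathbf{x}\in\mathcal{X}}\mathbf{x}^\top\mathbf{A}\mathbf{x}$. The relaxed E-optimal (respectively G-optimal) design problem is to minimize $f_E(\mathbf{M}(\mu)^{-1})$ (respectively $f_G(\mathbf{M}(\mu)^{-1})$) over those $\mu\in\Delta_K$ for which $\mathbf{M}(\mu)$ is invertible. For a sample size $n$, $f_{E,n}^\star=f_E\big((n\mathbf{M}(\mu_E^\star))^{-1}\big)$ and $f_{G,n}^\star=f_G\big((n\mathbf{M}(\mu_G^\star))^{-1}\big)$. A random matrix drawn from $\mu\in\Delta_K$ is a random matrix equal to $\mathbf{x}_k\mathbf{x}_k^\top$, where the index $k$ is chosen with probability $[\mu]_k$. By convention, $f_E(\mathbf{S}^{-1})=f_G(\mathbf{S}^{-1})=+\infty$ when $\mathbf{S}$ is singular. *)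

(* Defs.v *)
From HB Require Import structures.
From mathcomp Require Export all_boot all_order all_algebra.
From mathcomp Require Export all_classical all_reals all_analysis.
Export Order.TTheory GRing.Theory Num.Theory.
Export numFieldNormedType.Exports.

Set Implicit Arguments.
Unset Strict Implicit.
Unset Printing Implicit Defensive.

Local Open Scope classical_set_scope.
Local Open Scope ring_scope.

(* The norm that MathComp-Analysis puts on matrices is the max norm, so the
   Euclidean and spectral norms are defined here. *)
Definition enorm (R : realType) (d : nat) (v : 'cV[R]_d) : R :=
  Num.sqrt (\sum_(i < d) v i ord0 ^+ 2).

Definition opnorm (R : realType) (d : nat) (A : 'M[R]_d) : R :=
  sup [set enorm (A *m v) | v in [set v : 'cV[R]_d | enorm v <= 1]].

(* The set of experiments is given by the family x_1, ..., x_K.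
   Maxima over it are big operators based at 0, which is harmless because the
   terms are nonnegative: squared norms here, and the values of the quadratic
   form of a positive semidefinite matrix in fG. *)
Definition maxsqnorm (R : realType) (d K : nat) (x : 'I_K -> 'cV[R]_d) : R :=
  \big[Num.max/0]_(k < K) enorm (x k) ^+ 2.

Definition simplex (R : realType) (K : nat) : set 'rV[R]_K :=
  [set mu | (forall k, 0 <= mu ord0 k <= 1) /\ \sum_(k < K) mu ord0 k = 1].

Definition infomx (R : realType) (d K : nat) (x : 'I_K -> 'cV[R]_d)
    (mu : 'rV[R]_K) : 'M[R]_d :=
  \sum_(k < K) mu ord0 k *: (x k *m (x k)^T).

Definition fE (R : realType) (d : nat) (A : 'M[R]_d) : R := opnorm A.

Definition fG (R : realType) (d K : nat) (x : 'I_K -> 'cV[R]_d)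
    (A : 'M[R]_d) : R :=
  \big[Num.max/0]_(k < K) ((x k)^T *m A *m x k) ord0 ord0.

(* f (S^-1), with value +oo when S is singular *)
Definition crit_inv (R : realType) (d : nat) (f : 'M[R]_d -> R)
    (S : 'M[R]_d) : \bar R :=
  if S \in unitmx then (f (invmx S))%:E else +oo%E.

Definition relaxed_optimal (R : realType) (d K : nat) (x : 'I_K -> 'cV[R]_d)
    (f : 'M[R]_d -> R) (mu : 'rV[R]_K) : Prop :=
  [/\ simplex mu, infomx x mu \in unitmx &
      forall nu : 'rV[R]_K, simplex nu -> infomx x nu \in unitmx ->
        f (invmx (infomx x mu)) <= f (invmx (infomx x nu))].

(* The index k takes finitely many values: its type carries the discrete
   sigma-algebra. *)
Definition drawn_from (R : realType) (d K : nat) (x : 'I_K -> 'cV[R]_d)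
    (mu : 'rV[R]_K) (disp : measure_display) (T : measurableType disp)
    (P : probability T R) (W : T -> 'M[R]_d) : Prop :=
  exists k : T -> 'I_K,
    [/\ forall A : set 'I_K, measurable (k @^-1` A),
        forall j : 'I_K, P (k @^-1` [set j]) = (mu ord0 j)%:E &
        forall w : T, W w = x (k w) *m (x (k w))^T].

(* Mutual independence, with all sets of values allowed: this definition is
   only meant for variables whose preimages of arbitrary sets are measurable,
   as is the case for those satisfying drawn_from. *)
Definition mutually_independent (R : realType) (disp : measure_display)
    (T : measurableType disp) (P : probability T R) (V : Type) (n : nat)
    (W : 'I_n -> T -> V) : Prop :=
  forall (J : {set 'I_n}) (A : 'I_n -> set V),
    P (\bigcap_(i in [set` J]) (W i @^-1` A i))
    = (\prod_(i in J) P (W i @^-1` A i))%E.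

Definition iid_draws (R : realType) (d K : nat) (x : 'I_K -> 'cV[R]_d)
    (mu : 'rV[R]_K) (disp : measure_display) (T : measurableType disp)
    (P : probability T R) (n : nat) (W : 'I_n -> T -> 'M[R]_d) : Prop :=
  (forall i : 'I_n, drawn_from x mu P (W i)) /\ mutually_independent P W.

(* Main.v *)
Require Import Defs.
From mathcomp Require Import all_boot all_order all_algebra.
From mathcomp Require Import all_classical all_reals all_analysis.
From mathcomp Require Import ring lra.
Import Order.TTheory GRing.Theory Num.Theory.
Import numFieldNormedType.Exports.
Local Open Scope classical_set_scope.
Local Open Scope ring_scope.

(* Both parts follow from a matrix Chernoff bound: with probability
   at least 1 - d exp(- e^2 n / (2 l)), the sample matrix S dominates
   (1 - e) n M in the Loewner order, where l bounds the leverages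
   x_k^T M^-1 x_k. Inverting, both criteria of S^-1 are at most 1 / (1 - e)
   times their values at (n M)^-1.

   After whitening (M = I), the Chernoff bound is obtained without matrix
   exponentials: the potential is the trace of (I - (th / m) S)^m for a large
   even m. A draw multiplies its mean by at most 1 - b (1 - exp(- th l)) / l
   with b -> 1, and a direction in which S is small makes it at least
   (1 - th s / m)^m; then m tends to infinity.

   For E, l = L ||M^-1||. For G, the Kiefer-Wolfowitz theorem gives l = d,
   and for d >= 2 the resulting deviation sqrt (2 d log (d / delta) / n) is
   already below the deviation of the statement, because L ||M^-1|| >= d and
   sum_k mu_k (1 - mu_k) >= 1 - 1 / d; hence no Bernstein bound is needed.
   For d = 1 every x_k in the support of mu satisfies x_k^2 = M, so that
   S = n M almost surely. *)

Set Implicit Arguments.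
Unset Strict Implicit.
Unset Printing Implicit Defensive.

(** * Moments of a positive definite matrix *)

Definition dot (R : realType) (d : nat) (u v : 'cV[R]_d) : R :=
  (u^T *m v) ord0 ord0.

Lemma dotE (R : realType) (d : nat) (u v : 'cV[R]_d) :
  dot u v = \sum_i u i ord0 * v i ord0.
Proof. by rewrite /dot mxE; apply: eq_bigr => i _; rewrite mxE. Qed.

Lemma dotC (R : realType) (d : nat) (u v : 'cV[R]_d) : dot u v = dot v u.
Proof. by rewrite !dotE; apply: eq_bigr => i _; rewrite mulrC. Qed.

Lemma dotDr (R : realType) (d : nat) (u v w : 'cV[R]_d) :
  dot u (v + w) = dot u v + dot u w.
Proof. by rewrite /dot mulmxDr mxE. Qed.

Lemma dotZr (R : realType) (d : nat) (a : R) (u v : 'cV[R]_d) :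
  dot u (a *: v) = a * dot u v.
Proof. by rewrite /dot -scalemxAr mxE. Qed.

Lemma dotBr (R : realType) (d : nat) (u v w : 'cV[R]_d) :
  dot u (v - w) = dot u v - dot u w.
Proof. by rewrite /dot mulmxBr !mxE. Qed.

Lemma dot0r (R : realType) (d : nat) (u : 'cV[R]_d) : dot u 0 = 0.
Proof. by rewrite /dot mulmx0 mxE. Qed.

Lemma dotDl (R : realType) (d : nat) (u v w : 'cV[R]_d) :
  dot (u + v) w = dot u w + dot v w.
Proof. by rewrite dotC dotDr !(dotC w). Qed.

Lemma dotZl (R : realType) (d : nat) (a : R) (u v : 'cV[R]_d) :
  dot (a *: u) v = a * dot u v.
Proof. by rewrite dotC dotZr dotC. Qed.

Lemma dot_suml (R : realType) (d : nat) (I : finType) (F : I -> 'cV[R]_d) v :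
  dot (\sum_i F i) v = \sum_i dot (F i) v.
Proof. by rewrite /dot linear_sum mulmx_suml summxE. Qed.

Lemma dot_sumr (R : realType) (d : nat) (I : finType) (F : I -> 'cV[R]_d) u :
  dot u (\sum_i F i) = \sum_i dot u (F i).
Proof. by rewrite dotC dot_suml; apply: eq_bigr => i _; rewrite dotC. Qed.

Lemma dot_mulmxr (R : realType) (d e : nat) (A : 'M[R]_(d, e)) u v :
  dot u (A *m v) = dot (A^T *m u) v.
Proof. by rewrite /dot trmx_mul trmxK mulmxA. Qed.

Lemma dot_ge0 (R : realType) (d : nat) (u : 'cV[R]_d) : 0 <= dot u u.
Proof. by rewrite dotE sumr_ge0 // => i _; rewrite -expr2 sqr_ge0. Qed.

Lemma dot_eq0 (R : realType) (d : nat) (u : 'cV[R]_d) :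
  (dot u u == 0) = (u == 0).
Proof.
apply/idP/eqP => [|->]; last by rewrite /dot mulmx0 mxE.
rewrite dotE psumr_eq0 => [/allP u0|i _]; last by rewrite -expr2 sqr_ge0.
apply/colP => i; rewrite mxE; apply/eqP.
by have := u0 i (mem_index_enum _); rewrite -expr2 sqrf_eq0.
Qed.

Lemma dot_gt0 (R : realType) (d : nat) (u : 'cV[R]_d) :
  (0 < dot u u) = (u != 0).
Proof. by rewrite lt0r dot_eq0 dot_ge0 andbT. Qed.

Lemma enorm_ge0 (R : realType) (d : nat) (v : 'cV[R]_d) : 0 <= enorm v.
Proof. exact: sqrtr_ge0. Qed.

Lemma sqr_enorm (R : realType) (d : nat) (v : 'cV[R]_d) :
  enorm v ^+ 2 = dot v v.
Proof.
rewrite sqr_sqrtr; last by rewrite sumr_ge0 // => i _; rewrite sqr_ge0.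
by rewrite dotE; apply: eq_bigr => i _; rewrite expr2.
Qed.

Lemma outer_mul (R : realType) (d e : nat) (u : 'cV[R]_d) (y v : 'cV[R]_e) :
  (u *m y^T) *m v = dot y v *: u.
Proof.
by rewrite -mulmxA [y^T *m v]mx11_scalar mul_mx_scalar.
Qed.

Lemma outer_tr (R : realType) (d : nat) (y : 'cV[R]_d) :
  (y *m y^T)^T = y *m y^T.
Proof. by rewrite trmx_mul trmxK. Qed.

Lemma dot_outer (R : realType) (d : nat) (y u v : 'cV[R]_d) :
  dot u (y *m y^T *m v) = dot u y * dot y v.
Proof. by rewrite outer_mul dotZr mulrC. Qed.

Lemma mxtrace_mul_outer (R : realType) (d : nat) (A : 'M[R]_d) (u v : 'cV[R]_d) :
  \tr (A *m (u *m v^T)) = dot v (A *m u).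
Proof. by rewrite mulmxA mxtrace_mulC [v^T *m _]mx11_scalar mxtrace_scalar. Qed.

(** Evaluate at the minimizer [- b / c]; for [c = 0], a nonzero [b] would give the value -1
    somewhere. *)
Lemma nonneg_quadratic (R : realType) (a b c : R) : 0 <= c ->
  (forall t, 0 <= a + 2 * t * b + t ^+ 2 * c) -> b ^+ 2 <= a * c.
Proof.
rewrite le_eqVlt => /predU1P[<-|c0] h.
  have [->|b0] := eqVneq b 0; first by rewrite mulr0 expr0n.
  have := h (- (a + 1) / (2 * b)); rewrite mulr0 addr0.
  have -> : a + 2 * (- (a + 1) / (2 * b)) * b = -1 by field.
  by rewrite ler0N1.
have := h (- b / c).
have -> : a + 2 * (- b / c) * b + (- b / c) ^+ 2 * c = a - b ^+ 2 / c.
  by field; rewrite gt_eqF.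
by rewrite subr_ge0 ler_pdivrMr.
Qed.

Definition psd (R : realType) (d : nat) (A : 'M[R]_d) : Prop :=
  A^T = A /\ forall v, 0 <= dot v (A *m v).

Lemma psd_cauchy (R : realType) (d : nat) (A : 'M[R]_d) (u v : 'cV[R]_d) :
  psd A -> dot u (A *m v) ^+ 2 <= dot u (A *m u) * dot v (A *m v).
Proof.
move=> [At Age]; apply: nonneg_quadratic => // t.
have := Age (u + t *: v).
rewrite mulmxDr -scalemxAr !(dotDl, dotDr, dotZl, dotZr).
have -> : dot v (A *m u) = dot u (A *m v) by rewrite dot_mulmxr At dotC.
by congr (0 <= _); ring.
Qed.

Lemma psd1 (R : realType) (d : nat) : psd (1%:M : 'M[R]_d).
Proof. by split=> [|v]; rewrite ?trmx1 // mul1mx dot_ge0. Qed.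

Lemma dot_cauchy (R : realType) (d : nat) (u v : 'cV[R]_d) :
  dot u v ^+ 2 <= dot u u * dot v v.
Proof. by have := psd_cauchy u v (psd1 R d); rewrite !mul1mx. Qed.

Lemma trmxX (R : realType) (d : nat) (A : 'M[R]_d) k : (A ^+ k)^T = A^T ^+ k.
Proof.
elim: k => [|k IH]; first by rewrite !expr0 trmx1.
by rewrite exprS exprSr -!mulmxE trmx_mul IH.
Qed.

Lemma mulmx_exp (R : realType) (d : nat) (A : 'M[R]_d) i j (v : 'cV[R]_d) :
  A ^+ i *m (A ^+ j *m v) = A ^+ (i + j) *m v.
Proof. by rewrite mulmxA exprD. Qed.

Lemma dot_exp (R : realType) (d : nat) (A : 'M[R]_d) i j (u v : 'cV[R]_d) :
  A^T = A -> dot (A ^+ i *m u) (A ^+ j *m v) = dot u (A ^+ (i + j) *m v).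
Proof. by move=> At; rewrite -mulmx_exp [RHS]dot_mulmxr trmxX At. Qed.

(** The k-th moment of the spectral measure of [A] at [y]. Inequalities between moments replace
    diagonalization. *)
Definition moment (R : realType) (d : nat) (A : 'M[R]_d) (y : 'cV[R]_d) k : R :=
  dot y (A ^+ k *m y).

Lemma moment0 (R : realType) (d : nat) (A : 'M[R]_d) (y : 'cV[R]_d) :
  moment A y 0 = dot y y.
Proof. by rewrite /moment expr0 mul1mx. Qed.

Lemma moment1 (R : realType) (d : nat) (A : 'M[R]_d) (y : 'cV[R]_d) :
  moment A y 1 = dot y (A *m y).
Proof. by rewrite /moment expr1. Qed.

Section MomentLogConvexity.
Variables (R : realType) (d : nat) (A : 'M[R]_d) (y : 'cV[R]_d) (b : R).
Hypotheses (At : A^T = A) (b0 : 0 < b) (y0 : y != 0).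
Hypothesis Ab : forall v, b * dot v v <= dot v (A *m v).

Local Notation q := (moment A y).

Let psdA : psd A.
Proof. by split=> // v; rewrite (le_trans _ (Ab v)) // mulr_ge0 ?dot_ge0 ?ltW. Qed.

(** Cauchy-Schwarz for [A ^+ i *m y] and [A ^+ i.+1 *m y] with [i = k./2], in the form of [A] for
    odd [k] and in the Euclidean one for even [k]. *)
Lemma moment_log_convex k : q k.+1 ^+ 2 <= q k * q k.+2.
Proof.
rewrite /moment -(odd_double_half k) -addnn; case: (odd k); set i := k./2 => /=.
  have := psd_cauchy (A ^+ i *m y) (A ^+ i.+1 *m y) psdA.
  have AX j : A *m (A ^+ j *m y) = A ^+ j.+1 *m y by rewrite mulmxA exprS.
  by rewrite !AX !dot_exp // !(addnS, addSn, add0n, addn0).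
have := dot_cauchy (A ^+ i *m y) (A ^+ i.+1 *m y).
by rewrite !dot_exp // !(addnS, addSn, add0n, addn0).
Qed.

Lemma moment_gt0 k : 0 < q k.
Proof.
suff: 0 < q k /\ 0 < q k.+1 by case.
elim: k => [|k [qk qk1]].
  rewrite moment0 dot_gt0; split=> //; rewrite moment1.
  by rewrite (lt_le_trans _ (Ab y)) // mulr_gt0 // dot_gt0.
split=> //; rewrite -(pmulr_rgt0 _ qk) (lt_le_trans _ (moment_log_convex k)) //.
by rewrite exprn_gt0.
Qed.

Lemma moment_ratio_mono k l : (k <= l)%N -> q k.+1 / q k <= q l.+1 / q l.
Proof.
apply: (homo_leq (f := fun k => q k.+1 / q k) (@lexx _ _) (@le_trans _ _)) => {}k.
rewrite ler_pdivrMr ?moment_gt0 // mulrAC ler_pdivlMr ?moment_gt0 //.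
by rewrite -expr2 mulrC moment_log_convex.
Qed.

(** Chebyshev's inequality for the spectral measure: raising [j] by one multiplies the left side by
    [q j.+1 / q j] and the right side by a later ratio, which is no smaller. *)
Lemma moment_mul j k : q j * q k <= q 0 * q (j + k).
Proof.
elim: j => [|j IH]; first by rewrite add0n.
have qS i : q i.+1 = q i.+1 / q i * q i by rewrite divfK // gt_eqF // moment_gt0.
rewrite [q j.+1]qS addSn [q (j + k).+1]qS -mulrA [q 0 * _]mulrCA.
have qge0 i : 0 <= q i by rewrite ltW ?moment_gt0.
apply: ler_pM => //; rewrite ?divr_ge0 ?mulr_ge0 //.
by apply: moment_ratio_mono; exact: leq_addr.
Qed.

Lemma moment_succ_ge k : b * q k <= q k.+1.
Proof.
rewrite -(ler_pM2l (moment_gt0 0)) (le_trans _ (moment_mul 1 k)) //.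
rewrite mulrA ler_pM2r ?moment_gt0 // moment0 mulrC moment1; exact: Ab.
Qed.

(** Jensen's inequality, the spectral measure at a unit vector being a probability. *)
Lemma moment_exp_ge k : dot y y = 1 -> q 1 ^+ k <= q k.
Proof.
move=> y1; elim: k => [|k IH]; first by rewrite moment0 y1.
rewrite exprS (le_trans (ler_wpM2l (ltW (moment_gt0 1)) IH)) //.
by rewrite (le_trans (moment_mul 1 k)) // moment0 y1 mul1r.
Qed.

Lemma moment_succ_le k : (forall v, dot v (A *m v) <= dot v v) -> q k.+1 <= q k.
Proof.
move=> A1; rewrite -[leRHS]mul1r -ler_pdivrMr ?moment_gt0 //.
(* The ratio at 2k is a Rayleigh quotient of [A], taken at [A ^+ k *m y]. *)
apply: (le_trans (moment_ratio_mono (leq_addr k k))).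
rewrite ler_pdivrMr ?moment_gt0 // mul1r /moment -addnS -!dot_exp //.
by rewrite exprS -mulmxE -mulmxA A1.
Qed.

End MomentLogConvexity.

(** * Derivative of the trace of a power *)

Lemma map_deriv_mul (R : comNzRingType) (d : nat) (P Q : 'M[{poly R}]_d) :
  map_mx (@deriv R) (P *m Q) = map_mx (@deriv R) P *m Q + P *m map_mx (@deriv R) Q.
Proof.
apply/matrixP => i j; rewrite !mxE linear_sum -big_split /=.
by apply: eq_bigr => k _; rewrite !mxE derivM.
Qed.

Lemma map_deriv_exp (R : comNzRingType) (d : nat) (P : 'M[{poly R}]_d) k :
  map_mx (@deriv R) (P ^+ k.+1) =
  \sum_(j < k.+1) P ^+ j *m map_mx (@deriv R) P *m P ^+ (k - j).
Proof.
elim: k => [|k IH].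
  by rewrite big_ord1 /= subn0 !expr0 expr1 mul1mx mulmx1.
rewrite exprSr -mulmxE map_deriv_mul IH [in RHS]big_ord_recr /= subnn expr0 mulmx1.
congr (_ + _); rewrite mulmx_suml; apply: eq_bigr => j _.
by rewrite -!mulmxA subSn ?(ltnSE (ltn_ord j)) // exprSr.
Qed.

(** The curve evaluates a matrix of polynomials, so the formal Leibniz rule applies; the factors
    need not commute, hence one term for each position of [X]. The factor [C] will be [y *m y^T] for
    moments and 1 for the trace. *)
Lemma is_derive_trace_exp (R : realType) (d : nat) (A X C : 'M[R]_d) k (s : R) :
  is_derive s 1 (fun s => \tr ((A - s *: X) ^+ k.+1 *m C))
    (- \sum_(j < k.+1)
        \tr ((A - s *: X) ^+ j *m X *m (A - s *: X) ^+ (k - j) *m C)).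
Proof.
pose cst (B : 'M[R]_d) : 'M[{poly R}]_d := map_mx polyC B.
pose P := cst A - 'X *: cst X.
pose p := \tr (P ^+ k.+1 *m cst C).
have evC (B : 'M[R]_d) (t : R) : map_mx (horner_eval t) (cst B) = B.
  by apply/matrixP => i j; rewrite !mxE /horner_eval hornerC.
have evP (t : R) : map_mx (horner_eval t) P = A - t *: X.
  by apply/matrixP => i j; rewrite !mxE /horner_eval !hornerE.
have evX t n : map_mx (horner_eval t) (P ^+ n) = (A - t *: X) ^+ n.
  by rewrite -evP; exact: (rmorphXn (map_mx (horner_eval t))).
have evtr t (Q : 'M[{poly R}]_d) : (\tr Q).[t] = \tr (map_mx (horner_eval t) Q).
  by rewrite -[LHS]/(horner_eval t _) raddf_sum; apply: eq_bigr => i _; rewrite mxE.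
have dC (B : 'M[R]_d) : map_mx (@deriv R) (cst B) = 0.
  by apply/matrixP => i j; rewrite !mxE derivC.
have dP : map_mx (@deriv R) P = - cst X.
  apply/matrixP => i j.
  by rewrite !mxE derivB derivM derivX !derivC mulr0 addr0 mul1r sub0r.
have pE : horner p = (fun s => \tr ((A - s *: X) ^+ k.+1 *m C)).
  by apply/funext => t; rewrite /p evtr map_mxM evX evC.
have dpE : p^`().[s] = - \sum_(j < k.+1)
    \tr ((A - s *: X) ^+ j *m X *m (A - s *: X) ^+ (k - j) *m C).
  have -> : p^`() = \tr (map_mx (@deriv R) (P ^+ k.+1 *m cst C)).
    by rewrite raddf_sum; apply: eq_bigr => i _; rewrite [in RHS]mxE.
  rewrite map_deriv_mul dC mulmx0 addr0 map_deriv_exp dP evtr mulmx_suml.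
  rewrite -sumrN !raddf_sum; apply: eq_bigr => j _ /=.
  by rewrite mulmxN !mulNmx !raddfN /= !map_mxM !evX !evC.
by rewrite -dpE -pE; exact: is_derive_poly.
Qed.

Section RankOne.
Variables (R : realType) (d : nat) (A : 'M[R]_d) (y : 'cV[R]_d).

Let As (s : R) := A - s *: (y *m y^T).
Let h k (s : R) := moment (As s) y k.

Lemma is_derive_moment k (s : R) :
  is_derive s 1 (h k.+1) (- \sum_(j < k.+1) h j s * h (k - j) s).
Proof.
have -> : h k.+1 = fun s => \tr (As s ^+ k.+1 *m (y *m y^T)).
  by apply/funext => t; rewrite mxtrace_mul_outer.
apply: is_derive_eq; first exact: is_derive_trace_exp.
congr (- _); apply: eq_bigr => j _.
by rewrite mxtrace_mul_outer -!mulmxA [y^T *m _]mx11_scalar mul_mx_scalar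
  -scalemxAr dotZr mulrC.
Qed.

Lemma is_derive_trace m (s : R) :
  is_derive s 1 (fun s => \tr (As s ^+ m.+1)) (- (m.+1%:R * h m s)).
Proof.
have -> : (fun s => \tr (As s ^+ m.+1)) = fun s => \tr (As s ^+ m.+1 *m 1%:M).
  by apply/funext => t; rewrite mulmx1.
apply: is_derive_eq; first exact: is_derive_trace_exp.
congr (- _); rewrite mulr_natl -[in RHS](card_ord m.+1) -sumr_const.
apply: eq_bigr => j _.
have NX : As s ^+ (m - j) *m As s ^+ j = As s ^+ m.
  by rewrite mulmxE -exprD subnK ?(ltnSE (ltn_ord j)).
by rewrite -/(As s) mulmx1 mxtrace_mulC !mulmxA NX -mulmxA mxtrace_mul_outer.
Qed.
End RankOne.

Lemma is_derive_ndecr (R : realType) (f df : R -> R) (a b : R) : a <= b ->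
  (forall x : R, a <= x <= b -> is_derive x 1 f (df x)) ->
  (forall x, a <= x <= b -> 0 <= df x) -> f a <= f b.
Proof.
move=> ab fd df0.
have inab x : x \in `]a, b[ -> a <= x <= b.
  by rewrite in_itv => /andP[/ltW -> /ltW ->].
apply: (@ger0_derive1_ndecr R f a b) => // [x|x|].
- by move=> /inab /fd[].
- by move=> /inab xab; rewrite derive1E (@derive_val _ _ _ _ _ _ _ (fd _ xab)) df0.
apply: derivable_within_continuous => x.
by rewrite in_itv => /fd[].
Qed.

Lemma is_derive_expRM (R : realType) (r s : R) :
  is_derive s 1 (fun s => expR (r * s)) (r * expR (r * s)).
Proof.
have d1 : is_derive s 1 (fun s : R => r * s) r.
  have -> : (fun s : R => r * s) = r *: (@id R) by [].
  by apply: is_derive_eq; rewrite /GRing.scale /= mulr1.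
rewrite mulrC; exact: (is_derive1_comp (is_derive_expR (r * s)) d1).
Qed.

(* Along A_s = A - s y y^T, the derivative of h(s) = y^T A_s^(m-1) y is a sum
   of products of moments of A_s, which log-convexity bounds below by
   - (m l / b) h(s). Hence h decays at most exponentially, and - m h is the
   derivative of the trace of A_s^m. This replaces the Golden-Thompson
   inequality. *)
Lemma trace_rank_one_update (R : realType) (d : nat) (A : 'M[R]_d)
    (y : 'cV[R]_d) (a b l : R) k :
  A^T = A -> 0 <= a -> 0 < b -> b <= 1 -> 0 < l -> dot y y <= l ->
  (forall v, b * dot v v <= dot v ((A - a *: (y *m y^T)) *m v)) ->
  \tr ((A - a *: (y *m y^T)) ^+ k.+2) <=
  \tr (A ^+ k.+2)
  - b * ((1 - expR (- (k.+2%:R * a * l))) / l) * moment A y k.+1.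
Proof.
move=> At a0 b0 b1 l0 yl Ab.
have [->|y0] := eqVneq y 0.
  by rewrite mul0mx scaler0 subr0 /moment /dot !mulmx0 mxE mulr0 subr0.
pose As (s : R) := A - s *: (y *m y^T).
pose h j s := moment (As s) y j.
have Ast s : (As s)^T = As s by rewrite /As linearB linearZ /= outer_tr At.
have Asb s : s <= a -> forall v, b * dot v v <= dot v (As s *m v).
  move=> sa v; apply: (le_trans (Ab v)).
  rewrite !mulmxBl -!scalemxAl !dotBr !dotZr lerB // ler_wpM2r //.
  by rewrite dot_outer [dot y v]dotC -expr2 sqr_ge0.
have hgt0 j s : s <= a -> 0 < h j s by move=> sa; exact: (moment_gt0 _ b0 _ (Asb _ sa)).
(* Decay rate of [h k.+1]. Its derivative has k + 1 terms; taking k + 2 instead makes [b / l * r]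
   the exponent of the trace. *)
pose r := k.+2%:R * l / b.
have r0 : 0 <= r by rewrite !mulr_ge0 ?invr_ge0 // ltW.
have dh s : s <= a ->
    0 <= r * h k.+1 s - \sum_(j < k.+1) h j s * h (k - j)%N s.
  move=> sa; rewrite subr_ge0.
  have : \sum_(j < k.+1) h j s * h (k - j)%N s <= \sum_(j < k.+1) l / b * h k.+1 s.
    apply: ler_sum => j _.
    have jk : (j + (k - j) = k)%N by rewrite subnKC // -ltnS.
    have := @moment_mul _ _ _ _ _ (Ast s) b0 y0 (Asb s sa) j (k - j).
    rewrite jk => /le_trans -> //.
    rewrite moment0 mulrAC ler_pdivlMr // -mulrA.
    apply: ler_pM; rewrite ?dot_ge0 ?mulr_ge0 //; first exact/ltW/hgt0; first exact: ltW.
    rewrite mulrC; exact: (moment_succ_ge _ b0 _ (Asb _ sa)).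
  move=> /le_trans -> //; rewrite sumr_const card_ord -mulr_natl mulrA.
  rewrite (ler_wpM2r (ltW (hgt0 _ _ sa))) // /r mulrA.
  by rewrite !ler_pM2r ?invr_gt0 // ler_nat.
have hlow s : 0 <= s -> s <= a -> h k.+1 0 * expR (- r * s) <= h k.+1 s.
  move=> s0 sa.
  (* Integrating factor: [h k.+1 * E] is nondecreasing. *)
  pose E := fun s : R => expR (r * s).
  have : (h k.+1 * E) 0 <= (h k.+1 * E) s.
    apply: (@is_derive_ndecr _ _ (fun t => E t *
      (r * h k.+1 t - \sum_(j < k.+1) h j t * h (k - j)%N t))) => // t /andP[t0 ts].
      apply: is_derive_eq.
        exact: (is_deriveM (is_derive_moment A y k t) (is_derive_expRM r t)).
      rewrite /GRing.scale /= -/(As t) -/(E t) -/(h _ t).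
      rewrite [LHS](_ : _ = h k.+1 t * (r * E t)
        + E t * - (\sum_(j < k.+1) h j t * h (k - j)%N t)) //.
      by move: (h _ _) (E t) (\sum_(j < _) _) => u v w; ring.
    by rewrite mulr_ge0 ?expR_ge0 // dh // (le_trans ts).
  rewrite /E !fctE mulr0 expR0 mulr1 => hE.
  by rewrite mulNr expRN ler_pdivrMr ?expR_gt0.
(* With [c * r = k.+2%:R * h k.+1 0], the derivative of [G] below is k + 2 times the gap in
   [hlow]. *)
pose c := h k.+1 0 * (b / l).
pose g (s : R) := \tr (As s ^+ k.+2).
have rl : b / l * r = k.+2%:R by rewrite /r; field; rewrite !gt_eqF.
pose G : R -> R := c *: (fun s : R => expR (- r * s)) - g.
have GE t : G t = c * expR (- r * t) - g t by [].
pose dG (t : R) := k.+2%:R * (h k.+1 t - h k.+1 0 * expR (- r * t)).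
have : G 0 <= G a.
  apply: (@is_derive_ndecr R G dG 0 a a0) => [t /andP[t0 ta]|t /andP[t0 ta]].
    have D1 := is_derive_expRM (- r) t.
    have D2 : is_derive t 1 g (- (k.+2%:R * h k.+1 t)) := is_derive_trace A y k.+1 t.
    have D3 := is_deriveB (is_deriveZ c D1) D2.
    apply: (is_derive_eq D3).
    rewrite /GRing.scale /= /dG -rl /c.
    by move: (h _ _) (h _ _) (expR _) (b / l) => u1 u2 u3 u4; ring.
  by rewrite mulr_ge0 // subr_ge0 hlow.
rewrite !GE mulr0 expR0 mulr1 => gE.
have -> : moment A y k.+1 = h k.+1 0 by rewrite /h /As scale0r subr0.
have -> : A ^+ k.+2 = As 0 ^+ k.+2 by rewrite /As scale0r subr0.
rewrite -/(As a) -/(g a) -/(g 0).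
(* As [b <= 1], the factor 1 / b may be dropped from the decay rate. *)
have le1 : expR (- r * a) <= expR (- (k.+2%:R * a * l)).
  have -> : - r * a = - (k.+2%:R * a * l / b) by rewrite /r; ring.
  rewrite ler_expR lerN2 ler_pdivlMr //.
  by rewrite ler_piMr // !mulr_ge0 // ltW.
have : c * (1 - expR (- (k.+2%:R * a * l))) <= c * (1 - expR (- r * a)).
  apply: ler_wpM2l; last by rewrite lerB.
  by rewrite /c !mulr_ge0 ?invr_ge0 // ltW // hgt0.
have -> : b * ((1 - expR (- (k.+2%:R * a * l))) / l) * h k.+1 0
   = c * (1 - expR (- (k.+2%:R * a * l))) by rewrite /c; ring.
by lra.
Qed.

(** * Mean of the potential *)

Lemma big_tuple_cons (R : nmodType) (I : finType) n (F : n.+1.-tuple I -> R) :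
  \sum_t F t = \sum_i \sum_(t : n.-tuple I) F [tuple of i :: t].
Proof.
rewrite pair_big /= (reindex (fun q : I * n.-tuple I => [tuple of q.1 :: q.2])) //=.
exists (fun t => (thead t, behead_tuple t)) => [[i t] _|t _] /=.
  by rewrite theadE; congr pair; apply: val_inj.
by rewrite -tuple_eta.
Qed.

Section IteratedTrace.
Variables (R : realType) (d : nat) (I : finType) (p : I -> R) (y : I -> 'cV[R]_d).
Variables (l a b : R) (k : nat).
Hypotheses (p0 : forall i, 0 <= p i) (p1 : \sum_i p i = 1).
Hypothesis isotropic : \sum_i p i *: (y i *m (y i)^T) = 1%:M.
Hypotheses (l0 : 0 < l) (yl : forall i, dot (y i) (y i) <= l).
Hypotheses (a0 : 0 <= a) (b0 : 0 < b) (b1 : b <= 1).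

Let c := (1 - expR (- (k.+2%:R * a * l))) / l.

Let c0 : 0 <= c.
Proof.
rewrite divr_ge0 ?(ltW l0) // subr_ge0 -expR0 ler_expR oppr_le0.
by rewrite !mulr_ge0 // ltW.
Qed.

Lemma mxtrace_moment (A : 'M[R]_d) j : \tr (A ^+ j) = \sum_i p i * moment A (y i) j.
Proof.
rewrite -[A ^+ j]mulmx1 -isotropic mulmx_sumr raddf_sum; apply: eq_bigr => i _ /=.
by rewrite -scalemxAr mxtraceZ mxtrace_mul_outer.
Qed.

Lemma dot_sub_outer_ge (A : 'M[R]_d) (s : R) i v :
  (s + a * l) * dot v v <= dot v (A *m v) ->
  s * dot v v <= dot v ((A - a *: (y i *m (y i)^T)) *m v).
Proof.
rewrite mulmxBl -scalemxAl dotBr dotZr dot_outer [dot (y i) v]dotC -expr2 => Ab.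
have : a * dot v (y i) ^+ 2 <= a * (l * dot v v).
  rewrite ler_wpM2l // (le_trans (dot_cauchy _ _)) // mulrC ler_wpM2r ?dot_ge0 //.
by move: Ab; lra.
Qed.

(** The rank-one update is averaged. As [A] is at most the identity, the moment of order k + 1 may
    be lowered to order k + 2, whose mean is the trace of the same power by isotropy. Finally 1 - b
    c <= exp (- b c). *)
Lemma mean_trace_update (A : 'M[R]_d) : A^T = A ->
  (forall v, dot v (A *m v) <= dot v v) ->
  (forall v, (b + a * l) * dot v v <= dot v (A *m v)) ->
  \sum_i p i * \tr ((A - a *: (y i *m (y i)^T)) ^+ k.+2) <=
  expR (- (b * c)) * \tr (A ^+ k.+2).
Proof.
move=> At A1 Ab.
have Ab' v : b * dot v v <= dot v (A *m v).
  rewrite (le_trans _ (Ab v)) // ler_wpM2r ?dot_ge0 // lerDl mulr_ge0 //; exact: ltW.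
have mge0 i j : 0 <= moment A (y i) j.
  have [->|y0] := eqVneq (y i) 0; first by rewrite /moment !mulmx0 !dot0r.
  exact/ltW/(moment_gt0 At b0 y0 Ab').
have mle i : moment A (y i) k.+2 <= moment A (y i) k.+1.
  have [->|y0] := eqVneq (y i) 0; first by rewrite /moment !mulmx0 !dot0r.
  exact: (moment_succ_le At b0 y0 Ab').
have step : \sum_i p i * \tr ((A - a *: (y i *m (y i)^T)) ^+ k.+2) <=
    \sum_i p i * (\tr (A ^+ k.+2) - b * c * moment A (y i) k.+2).
  apply: ler_sum => i _; rewrite ler_wpM2l //.
  apply: (le_trans (trace_rank_one_update _ At a0 b0 b1 l0 (yl i) _)).
    by move=> v; apply: dot_sub_outer_ge.
  by rewrite lerB // -/c ler_wpM2l // mulr_ge0 // ltW.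
apply: (le_trans step).
under eq_bigr do rewrite mulrBr.
rewrite sumrB -mulr_suml p1 mul1r.
under eq_bigr do rewrite mulrCA.
rewrite -mulr_sumr -mxtrace_moment -[X in X - _]mul1r -mulrBl.
rewrite ler_wpM2r ?expR_ge1Dx //.
by rewrite mxtrace_moment sumr_ge0 // => i _; rewrite mulr_ge0.
Qed.

(** Induction peels off the first draw. The margin n a l above [b] pays for the draws, each of which
    lowers the matrix by at most a l, so that [b] remains a lower bound throughout. *)
Lemma mean_trace_iter n (A : 'M[R]_d) : A^T = A ->
  (forall v, dot v (A *m v) <= dot v v) ->
  (forall v, (b + n%:R * (a * l)) * dot v v <= dot v (A *m v)) ->
  \sum_(t : n.-tuple I) (\prod_(i < n) p (tnth t i)) *
    \tr ((A - a *: \sum_(i < n) y (tnth t i) *m (y (tnth t i))^T) ^+ k.+2) <=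
  expR (- (b * c)) ^+ n * \tr (A ^+ k.+2).
Proof.
elim: n A => [|n IH] A At A1 Ab.
  rewrite (big_pred1 [tuple]) => [|t]; last by apply/esym/eqP; exact: tuple0.
  by rewrite !big_ord0 scaler0 subr0 mul1r.
rewrite big_tuple_cons exprSr -mulrA.
have al0 : 0 <= a * l by rewrite mulr_ge0 // ltW.
have step : \sum_i p i * \tr ((A - a *: (y i *m (y i)^T)) ^+ k.+2) <=
  expR (- (b * c)) * \tr (A ^+ k.+2).
  apply: mean_trace_update => // v; rewrite (le_trans _ (Ab v)) // ler_wpM2r ?dot_ge0 //.
  by rewrite lerD2l -[leLHS]mul1r ler_wpM2r // ler1n.
apply: le_trans (ler_wpM2l (exprn_ge0 _ (expR_ge0 _)) step).
rewrite mulr_sumr; apply: ler_sum => i _.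
rewrite mulrCA; apply: le_trans (ler_wpM2l (p0 i) (IH _ _ _ _)).
- rewrite mulr_sumr le_eqVlt; apply/orP; left; apply/eqP; apply: eq_bigr => t _.
  rewrite !big_ord_recl !tnth0.
  under [\prod_(j < n) _]eq_bigr do rewrite tnthS.
  under [\sum_(j < n) _]eq_bigr do rewrite tnthS.
  by rewrite mulrA scalerDr opprD addrA.
- by rewrite linearB linearZ /= outer_tr At.
- move=> v; apply: le_trans (A1 v).
  rewrite mulmxBl -scalemxAl dotBr dotZr dot_outer [dot (y i) v]dotC -expr2.
  by rewrite gerBl mulr_ge0 ?sqr_ge0.
move=> v; apply: dot_sub_outer_ge.
have <- : b + n.+1%:R * (a * l) = b + n%:R * (a * l) + a * l.
  by rewrite -natr1 mulrDl mul1r addrA.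
exact: Ab.
Qed.
End IteratedTrace.

(** * Traces of even powers and scalar inequalities *)

Lemma mxtrace_sqr (R : realType) (d : nat) (C : 'M[R]_d) : C^T = C ->
  \tr (C *m C) = \sum_i dot (row i C)^T (row i C)^T.
Proof.
move=> Ct; apply: eq_bigr => i _; rewrite mxE dotE; apply: eq_bigr => j _.
by rewrite -{2}Ct !mxE.
Qed.

(** Cauchy-Schwarz on each row of [C]; the squared norms of the rows add up to the trace. *)
Lemma mxtrace_sqr_ge (R : realType) (d : nat) (C : 'M[R]_d) v : C^T = C ->
  dot v (C *m (C *m v)) <= \tr (C *m C) * dot v v.
Proof.
move=> Ct; rewrite dot_mulmxr Ct dotE mxtrace_sqr // mulr_suml ler_sum // => i _.
have -> : (C *m v) i ord0 = dot (row i C)^T v.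
  by rewrite dotE mxE; apply: eq_bigr => j _; rewrite !mxE.
by rewrite -expr2 dot_cauchy.
Qed.

Lemma ler_of_expR (R : realType) (P Q : R) : 0 < Q ->
  (forall e, 0 < e -> P <= Q * expR e) -> P <= Q.
Proof.
move=> Q0 PQ; apply/ler_addgt0Pr => e e0.
have e1 : 1 < 1 + e / Q by rewrite ltrDl divr_gt0.
have := PQ _ (ln_gt0 e1); rewrite lnK ?posrE ?(lt_trans ltr01) //.
by rewrite mulrDr mulr1 mulrCA divff ?gt_eqF // mulr1.
Qed.

(** The difference vanishes at 0 and has derivative - ln (1 - t) - t >= 0. *)
Lemma xlnx_lower_bound (R : realType) (e : R) : 0 < e < 1 ->
  e ^+ 2 / 2 <= e + (1 - e) * ln (1 - e).
Proof.
move=> /andP[e0 e1].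
pose f (t : R) := t + (1 - t) * ln (1 - t) - t ^+ 2 / 2.
suff : f 0 <= f e.
  by rewrite /f subr0 ln1 mulr0 addr0 expr0n mul0r subr0 subr_ge0.
apply: (@is_derive_ndecr R f (fun t => - ln (1 - t) - t) 0 e (ltW e0)) => t /andP[t0 te].
  have t1 : 0 < 1 - t by rewrite subr_gt0 (le_lt_trans te).
  have Dl := is_derive1_ln t1.
  have Ds : is_derive t 1 (fun t : R => 1 - t) (- 1).
    have -> : (fun t : R => 1 - t) = (cst 1 : R -> R) - @id R by [].
    by rewrite -[- 1]add0r; exact: is_deriveB.
  have Dls := @is_derive1_comp R (@ln R) (fun t : R => 1 - t) t _ _ Dl Ds.
  have D1 := is_deriveM Ds Dls.
  have D2 := is_deriveD (is_derive_id t 1) D1.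
  have D3 := is_deriveB D2 (is_deriveZ (2^-1) (is_deriveX 2 (is_derive_id t 1))).
  have -> : f = @id R + (fun t : R => 1 - t) * ((@ln R) \o (fun t : R => 1 - t))
                - 2^-1 *: (@id R ^+ 2).
    by apply/funext => u; rewrite /f !fctE /GRing.scale /= [_ / 2]mulrC.
  apply: (is_derive_eq D3).
  rewrite /GRing.scale /= !expr1.
  by field; rewrite gt_eqF.
by rewrite subr_ge0 lerNr le_ln1Dx // ltrN2 (le_lt_trans te).
Qed.

(** Jensen's inequality at the normalized [u] bounds the power of [r] by a moment. The exponent is
    even, so that this moment is a value of the form of a square and is bounded by its trace. *)
Lemma exp_le_mxtrace (R : realType) (d : nat) (B : 'M[R]_d) (b r : R) u j :
  B^T = B -> 0 < b -> (forall v, b * dot v v <= dot v (B *m v)) ->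
  0 <= r -> u != 0 -> r * dot u u <= dot u (B *m u) ->
  r ^+ (j + j) <= \tr (B ^+ (j + j)).
Proof.
move=> Bt b0 Bb r0 u0 ru.
have uu : 0 < dot u u by rewrite dot_gt0.
pose w := (Num.sqrt (dot u u))^-1 *: u.
have ww : dot w w = 1.
  rewrite dotZl dotZr mulrA -expr2 exprVn (sqr_sqrtr (ltW uu)) mulVf // gt_eqF //.
have w0 : w != 0 by rewrite -dot_gt0 ww.
have rw : r <= moment B w 1.
  rewrite moment1 -scalemxAr dotZl dotZr mulrA -expr2 exprVn (sqr_sqrtr (ltW uu)).
  by rewrite mulrC ler_pdivlMr.
apply: (@le_trans _ _ (moment B w 1 ^+ (j + j))).
  by rewrite lerXn2r // nnegrE // (le_trans r0).
apply: (le_trans (moment_exp_ge Bt b0 w0 Bb _ ww)).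
have Bjt : (B ^+ j)^T = B ^+ j by rewrite trmxX Bt.
have := mxtrace_sqr_ge w Bjt; rewrite ww mulr1.
by rewrite mulmx_exp -/(moment B w (j + j)) mulmxE -exprD.
Qed.

(** * Chernoff bound *)

Section IsotropicChernoff.
Variables (R : realType) (d : nat) (I : finType) (p : I -> R) (y : I -> 'cV[R]_d).
Variables (l : R) (n : nat).
Hypotheses (d0 : (0 < d)%N) (p0 : forall i, 0 <= p i) (p1 : \sum_i p i = 1).
Hypothesis isotropic : \sum_i p i *: (y i *m (y i)^T) = 1%:M.
Hypotheses (l0 : 0 < l) (yl : forall i, dot (y i) (y i) <= l).

Let S (t : n.-tuple I) := \sum_(i < n) y (tnth t i) *m (y (tnth t i))^T.
Let w (t : n.-tuple I) := \prod_(i < n) p (tnth t i).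
Let small s t : bool := `[< exists v, dot v (S t *m v) < s * dot v v >].
Let c th := (1 - expR (- (th * l))) / l.

Let w0 t : 0 <= w t. Proof. exact: prodr_ge0. Qed.

Let St t : (S t)^T = S t.
Proof. by rewrite linear_sum; apply: eq_bigr => i _; exact: outer_tr. Qed.

Let dotS t v : dot v (S t *m v) = \sum_(i < n) dot v (y (tnth t i)) ^+ 2.
Proof.
rewrite mulmx_suml dot_sumr; apply: eq_bigr => i _.
by rewrite dot_outer [dot (y _) v]dotC expr2.
Qed.

Let dotS_le t v : dot v (S t *m v) <= n%:R * l * dot v v.
Proof.
rewrite dotS -mulrA mulr_natl -[X in _ *+ X]card_ord -sumr_const ler_sum // => i _.
by rewrite (le_trans (dot_cauchy _ _)) // mulrC ler_wpM2r ?dot_ge0.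
Qed.

(** Markov's inequality for the trace of (I - (th / m) S)^m with m = [(j + j).+2]. The upper bounds
    on [th] keep this matrix and the base of the power on the left positive. *)
Lemma chernoff_power j (th s : R) : 0 < th -> 0 <= s ->
  th * (n%:R * l) < (j + j).+2%:R -> th * s < (j + j).+2%:R ->
  (1 - th * s / (j + j).+2%:R) ^+ (j + j).+2 * \sum_(t | small s t) w t <=
  d%:R * expR (- ((1 - th * (n%:R * l) / (j + j).+2%:R) * c th)) ^+ n.
Proof.
move=> th0 s0; set m : R := (j + j).+2%:R => nm sm.
have m0 : 0 < m by rewrite ltr0n.
(* [b] bounds I - a S below because S <= n l, and b + n a l = 1 is the margin available at the
   identity. *)
pose a := th / m; pose b := 1 - th * (n%:R * l) / m.
have a0 : 0 < a by rewrite divr_gt0.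
have b0 : 0 < b by rewrite subr_gt0 ltr_pdivrMr // mul1r.
have b1 : b <= 1 by rewrite gerBl !mulr_ge0 ?invr_ge0 // ltW.
have := @mean_trace_iter _ _ _ p y l a b (j + j) p0 p1 isotropic l0 yl
  (ltW a0) b0 b1 n 1%:M.
rewrite trmx1 => /(_ erefl) H.
have {}H := H _ _.
have ma : m * a = th by rewrite /a mulrC divfK // gt_eqF.
have expr1n : (1%:M : 'M[R]_d) ^+ (j + j).+2 = 1%:M by exact: expr1n.
rewrite ma expr1n mxtrace1 in H.
rewrite [leRHS]mulrC.
apply: le_trans (H _ _) => [|v|v].
- rewrite mulr_sumr [leRHS](bigID (small s)) -[leLHS]addr0 lerD //.
    apply: ler_sum => t /asboolP[v vs].
    rewrite mulrC ler_wpM2l //.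
    have v0 : v != 0.
      by apply/eqP => v0; move: vs; rewrite v0 /dot !mulmx0 mxE mulr0 ltxx.
    have -> : (j + j).+2 = (j.+1 + j.+1)%N by rewrite addnS.
    apply: (@exp_le_mxtrace _ _ _ b _ v).
    + by rewrite linearB linearZ /= trmx1 St.
    + by [].
    + move=> u; rewrite mulmxBl mul1mx -scalemxAl dotBr dotZr.
      have := ler_wpM2l (ltW a0) (dotS_le t u).
      have -> : b * dot u u = dot u u - a * (n%:R * l * dot u u) by rewrite /b /a; ring.
      by rewrite lerD2l lerN2.
    + by rewrite subr_ge0 ler_pdivrMr // mul1r ltW.
    + by [].
    rewrite mulmxBl mul1mx -scalemxAl dotBr dotZr.
    have := ler_wpM2l (ltW a0) (ltW vs).
    have -> : (1 - th * s / m) * dot v v = dot v v - a * (s * dot v v).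
      by rewrite /a; ring.
    by rewrite lerD2l lerN2.
  apply: sumr_ge0 => t _; apply: mulr_ge0; first exact: w0.
  have -> : (j + j).+2 = (j.+1 + j.+1)%N by rewrite addnS.
  rewrite exprD -mulmxE mxtrace_sqr ?sumr_ge0 // => [i _|]; first exact: dot_ge0.
  by rewrite trmxX linearB linearZ /= trmx1 St.
- by rewrite mul1mx.
rewrite mul1mx; have -> : b + n%:R * (a * l) = 1 by rewrite /b /a; ring.
by rewrite mul1r.
Qed.

(** The limit of [chernoff_power] as m grows, in finite form: for each [e > 0] some m loses at most
    a factor exp e. *)
Lemma chernoff_laplace (th s : R) : 0 < th -> 0 <= s ->
  \sum_(t | small s t) w t <= d%:R * expR (th * s - n%:R * c th).
Proof.
move=> th0 s0; apply: ler_of_expR => [|e e0].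
  by rewrite mulr_gt0 ?expR_gt0 // ltr0n.
have c0 : 0 <= c th.
  rewrite divr_ge0 ?(ltW l0) // subr_ge0 -expR0 ler_expR oppr_le0.
  by rewrite mulr_ge0 // ltW.
(* [D / m] is the error in the exponent: the first term comes from (1 - th s / m)^m against exp (-
   th s), the second from replacing b by 1. *)
pose D := 2 * (th * s) ^+ 2 + n%:R * c th * (th * (n%:R * l)).
have ths : 0 <= th * s by rewrite mulr_ge0 // ltW.
have thn : 0 <= th * (n%:R * l) by rewrite !mulr_ge0 // ltW.
have D0 : 0 <= D.
  apply: addr_ge0; first by rewrite mulr_ge0 ?sqr_ge0.
  exact: mulr_ge0 (mulr_ge0 (ler0n _ _) c0) thn.
(* The three terms ensure D / m <= e, th s / m < 1 / 2 and the positivity of b. *)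
pose x := D / e + 2 * (th * s) + th * (n%:R * l).
pose j := Num.truncn x.
set m : R := (j + j).+2%:R.
have xm : x < m.
  rewrite (lt_le_trans (truncnS_gt x)) // ler_nat -/j.
  by rewrite ltnS (leq_trans (leq_addr j j)).
have De : 0 <= D / e by rewrite divr_ge0 // ltW.
have m0 : 0 < m by rewrite ltr0n.
have m1 : 2 * (th * s) < m by move: xm; rewrite /x; lra.
set P := \sum_(t | _) _.
have H : (1 - th * s / m) ^+ (j + j).+2 * P <=
    d%:R * expR (- ((1 - th * (n%:R * l) / m) * c th)) ^+ n.
  by apply: chernoff_power => //; move: xm; rewrite /x -/m; lra.
pose u := th * s / m.
have u0 : 0 <= u by rewrite divr_ge0 // ltW.
have u2 : 2 * u < 1 by rewrite /u mulrA ltr_pdivrMr // mul1r.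
have u1 : 0 < 1 - u by lra.
(* Uses exp z >= 1 + z and (1 - u) (1 + u + 2 u^2) = 1 + u^2 (1 - 2 u). *)
have low : expR (- (u + 2 * u ^+ 2)) <= 1 - u.
  rewrite expRN -[leRHS]invrK lef_pV2 ?posrE ?invr_gt0 ?expR_gt0 //.
  apply: le_trans (expR_ge1Dx _); rewrite -[leLHS]mul1r ler_pdivrMr //.
  by nra.
have P0 : 0 <= P by apply: sumr_ge0.
have := le_trans (ler_wpM2r P0 _) H.
move=> /(_ (expR (- (u + 2 * u ^+ 2)) ^+ (j + j).+2)).
rewrite lerXn2r ?nnegrE ?expR_ge0 ?(ltW u1) // => /(_ isT).
rewrite -!expRM_natl -/m [expR _ * P]mulrC -ler_pdivlMr ?expR_gt0 //.
move=> /le_trans; apply.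
rewrite -expRN -[leLHS]mulrA -expRD -[leRHS]mulrA -expRD ler_wpM2l // ler_expR.
have De2 : D / m <= e.
  rewrite ler_pdivrMr // mulrC -ler_pdivrMr //; move: xm; rewrite /x; lra.
rewrite [leLHS](_ : _ = th * s - n%:R * c th + D / m) ?lerD2l //.
by rewrite /D /u; field; rewrite gt_eqF.
Qed.

Lemma isotropic_chernoff (e : R) : 0 < e < 1 ->
  \sum_(t | small ((1 - e) * n%:R) t) w t <=
  d%:R * expR (- (e ^+ 2 * n%:R / (2 * l))).
Proof.
move=> e01; have /andP[e0 e1] := e01.
have e1' : 0 < 1 - e by rewrite subr_gt0.
have ln0 : ln (1 - e) < 0 by rewrite ln_lt0 // e1' /= gtrBl.
(* The minimizer of the exponent th s - n c(th) for s = (1 - e) n: it satisfies exp (- th l) = 1 -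
   e. *)
pose th := - ln (1 - e) / l.
have th0 : 0 < th by rewrite divr_gt0 // oppr_gt0.
apply: le_trans (@chernoff_laplace th _ th0 _) _; first by rewrite mulr_ge0 // ltW.
rewrite ler_wpM2l // ler_expR /c.
have -> : - (th * l) = ln (1 - e) by rewrite /th divfK ?gt_eqF // opprK.
rewrite lnK ?posrE // -subr_ge0.
have -> : - (e ^+ 2 * n%:R / (2 * l))
    - (th * ((1 - e) * n%:R) - n%:R * ((1 - (1 - e)) / l))
  = n%:R / l * (e + (1 - e) * ln (1 - e) - e ^+ 2 / 2).
  by rewrite /th; field; rewrite gt_eqF.
by rewrite mulr_ge0 ?divr_ge0 ?(ltW l0) // subr_ge0 xlnx_lower_bound.
Qed.
End IsotropicChernoff.

(** * Positive definite matrices and whitening *)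

Lemma dot_col_mx (R : realType) (d e : nat) (u1 v1 : 'cV[R]_d) (u2 v2 : 'cV[R]_e) :
  dot (col_mx u1 u2) (col_mx v1 v2) = dot u1 v1 + dot u2 v2.
Proof. by rewrite /dot tr_col_mx mul_row_col mxE. Qed.

Definition posdef (R : realType) (d : nat) (M : 'M[R]_d) : Prop :=
  M^T = M /\ forall v, v != 0 -> 0 < dot v (M *m v).

Lemma posdef_psd (R : realType) (d : nat) (M : 'M[R]_d) : posdef M -> psd M.
Proof.
move=> [Mt M0]; split=> // v.
by have [->|/M0/ltW //] := eqVneq v 0; rewrite mulmx0 /dot mulmx0 mxE.
Qed.

(** By Cauchy-Schwarz against [M *m v], a zero of the quadratic form lies in the kernel. *)
Lemma psd_posdef (R : realType) (d : nat) (M : 'M[R]_d) :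
  psd M -> M \in unitmx -> posdef M.
Proof.
move=> pM uM; have [Mt Mge] := pM; split=> // v v0.
rewrite lt0r Mge andbT; apply: contra v0 => /eqP vMv.
have := psd_cauchy (M *m v) v pM; rewrite vMv mulr0 => MvMv.
have /eqP : dot (M *m v) (M *m v) == 0 by rewrite -sqrf_eq0 eq_le MvMv sqr_ge0.
by move=> /eqP; rewrite dot_eq0 => /eqP Mv0; rewrite -(mulKmx uM v) Mv0 mulmx0.
Qed.

Lemma posdef_unitmx (R : realType) (d : nat) (M : 'M[R]_d) : posdef M -> M \in unitmx.
Proof.
move=> [Mt M0]; rewrite -row_free_unit -kermx_eq0; apply/rowV0P => u /sub_kermxP uM.
apply/eqP; apply: contraT => u0.
have := M0 u^T; rewrite -trmx_eq0 trmxK => /(_ u0).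
have -> : M *m u^T = 0 by rewrite -Mt -trmx_mul uM trmx0.
by rewrite /dot mulmx0 mxE ltxx.
Qed.

(* Cholesky: eliminate the first row and column, then recurse on the Schur
   complement. *)
Lemma posdef_whitening (R : realType) (d : nat) (M : 'M[R]_d) :
  posdef M -> exists C : 'M[R]_d, C *m M *m C^T = 1%:M.
Proof.
elim: d M => [|d IH] M; first by exists 1%:M; rewrite [LHS]flatmx0 [RHS]flatmx0.
rewrite -[d.+1]/(1 + d)%N in M * => -[Mt M0].
pose a := ulsubmx M ord0 ord0; pose c := dlsubmx M; pose D := drsubmx M.
have ME : M = block_mx a%:M c^T c D.
  by rewrite -[LHS]submxK -mx11_scalar trmx_dlsub Mt.
have Dt : D^T = D by rewrite trmx_drsub Mt.
have a0 : 0 < a.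
  have := M0 (col_mx 1%:M 0); rewrite -[_ == 0]negbK => /(_ _).
  rewrite ME mul_block_col !mulmx0 !addr0 !mulmx1 dot_col_mx.
  rewrite /dot trmx0 mul0mx trmx1 mul1mx !mxE eqxx mulr1n addr0; apply.
  rewrite negbK; apply/negP => /eqP/(congr1 usubmx); rewrite col_mxKu => /matrixP.
  by move=> /(_ ord0 ord0); rewrite !mxE /= => /eqP; rewrite oner_eq0.
pose S := D - a^-1 *: (c *m c^T).
have [|C' C'S] := IH S.
  split=> [|w w0]; first by rewrite linearB linearZ /= Dt outer_tr.
  (* The first coordinate minimizes the form of [M] for the given [w]; the minimum is the form of
     the Schur complement. *)
  pose v : 'cV[R]_(1 + d) := col_mx (- a^-1 *: (c^T *m w)) w.
  have -> : dot w (S *m w) = dot v (M *m v).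
    rewrite ME mul_block_col mul_scalar_mx scalerA mulrN divff ?gt_eqF //.
    rewrite scaleN1r addNr dot_col_mx dot0r add0r.
    rewrite mulmxBl -scalemxAl -scalemxAr -mulmxA.
    by rewrite scaleNr addrC.
  apply: M0; apply: contra w0 => /eqP/(congr1 dsubmx).
  by rewrite col_mxKd linear0 => ->.
pose s := (Num.sqrt a)^-1.
have sas : s * a * s = 1.
  by rewrite mulrAC -expr2 exprVn (sqr_sqrtr (ltW a0)) mulVf ?gt_eqF.
(* Inverse of the block Cholesky factor, with [s] the inverse square root of the pivot. *)
exists (block_mx s%:M 0 (- a^-1 *: (C' *m c)) C').
rewrite ME mulmx_block !mul0mx !addr0.
have -> : - a^-1 *: (C' *m c) *m a%:M + C' *m c = 0.
  by rewrite mul_mx_scalar scalerA mulrN divff ?gt_eqF // scaleN1r addNr.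
have -> : - a^-1 *: (C' *m c) *m c^T + C' *m D = C' *m S.
  by rewrite mulmxBr -scalemxAr -scalemxAl mulmxA scaleNr addrC.
rewrite tr_block_mx trmx0 tr_scalar_mx mulmx_block !mulmx0 !mul0mx !addr0 !add0r C'S.
have -> : (s%:M *m a%:M) *m (- a^-1 *: (C' *m c))^T + s%:M *m c^T *m C'^T = 0.
  rewrite -scalar_mxM linearZ /= trmx_mul -scalemxAr -mulmxA !mul_scalar_mx scalerA.
  by rewrite mulNr mulrCA mulVf ?gt_eqF // mulr1 scaleNr addNr.
by rewrite -!scalar_mxM sas -scalar_mx_block.
Qed.

Lemma whitening_gram (R : realType) (d : nat) (M C : 'M[R]_d) :
  M \in unitmx -> C *m M *m C^T = 1%:M -> C^T *m C = invmx M.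
Proof.
move=> uM; rewrite -mulmxA => /mulmx1C; rewrite -mulmxA => MCC.
by rewrite -[LHS](mulKmx uM) MCC mulmx1.
Qed.

(** The whitened vectors [C *m x i] are isotropic, with the leverages of the [x i] as squared
    norms. *)
Lemma matrix_chernoff (R : realType) (d : nat) (I : finType) (p : I -> R)
    (x : I -> 'cV[R]_d) (l e : R) (n : nat) :
  let M := \sum_i p i *: (x i *m (x i)^T) in
  let S := fun t : n.-tuple I => \sum_(i < n) x (tnth t i) *m (x (tnth t i))^T in
  (0 < d)%N -> (forall i, 0 <= p i) -> \sum_i p i = 1 -> M \in unitmx ->
  0 < l -> (forall i, dot (x i) (invmx M *m x i) <= l) -> 0 < e < 1 ->
  \sum_(t : n.-tuple I | `[< exists v, dot v (S t *m v) <
                              (1 - e) * n%:R * dot v (M *m v) >])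
    \prod_(i < n) p (tnth t i) <=
  d%:R * expR (- (e ^+ 2 * n%:R / (2 * l))).
Proof.
move=> M S d0 p0 p1 uM l0 xl e01.
have Mt : M^T = M.
  by rewrite linear_sum; apply: eq_bigr => i _; rewrite linearZ /= outer_tr.
have pM : psd M.
  split=> // v; rewrite mulmx_suml dot_sumr sumr_ge0 // => i _.
  by rewrite -scalemxAl dotZr dot_outer [dot (x i) v]dotC mulr_ge0 // -expr2 sqr_ge0.
have [C CMC] := posdef_whitening (psd_posdef pM uM).
have CC := whitening_gram uM CMC.
pose y i := C *m x i.
have yy i : y i *m (y i)^T = C *m (x i *m (x i)^T) *m C^T.
  by rewrite trmx_mul !mulmxA.
have iso : \sum_i p i *: (y i *m (y i)^T) = 1%:M.
  rewrite -CMC mulmx_sumr mulmx_suml; apply: eq_bigr => i _.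
  by rewrite yy -scalemxAr -scalemxAl.
have yl i : dot (y i) (y i) <= l.
  by rewrite dot_mulmxr mulmxA CC dotC.
apply: le_trans (isotropic_chernoff n d0 p0 p1 iso l0 yl e01).
rewrite [leLHS]big_mkcond [leRHS]big_mkcond ler_sum // => t _.
case: asboolP => [[v vS]|_]; last by case: ifP => // _; exact: prodr_ge0.
(* The witness is the inverse of [C^T] applied to [v]. *)
rewrite ifT //; apply/asboolP; exists (C *m (M *m v)).
have Cv : C^T *m (C *m (M *m v)) = v by rewrite mulmxA CC mulKmx.
have -> : \sum_(i < n) y (tnth t i) *m (y (tnth t i))^T = C *m S t *m C^T.
  by rewrite mulmx_sumr mulmx_suml; apply: eq_bigr => i _; rewrite yy.
rewrite -!mulmxA Cv ![dot _ (C *m _)]dot_mulmxr Cv.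
exact: vS.
Qed.

(** * Kiefer-Wolfowitz theorem *)

Lemma compact_simplex (R : realType) (K : nat) : compact (@simplex R K).
Proof.
pose f (mu : 'rV[R]_K) := \sum_(k < K) mu ord0 k.
have cf : continuous f.
  by apply: continuous_big => [|k _]; [exact: add_continuous|exact: coord_continuous].
have -> : @simplex R K =
    [set v : 'rV[R]_K | forall i, `[0, 1]%classic (v ord0 i)] `&` f @^-1` [set 1].
  apply/seteqP; split=> mu /= [mu01 sum1]; split=> // k; have := mu01 k;
    by rewrite in_itv.
apply: compact_closedI.
  by apply: (@rV_compact R K (fun=> `[0, 1]%classic)) => i; exact: segment_compact.
by apply: preimage_closed => [mu _|]; [exact: cf|exact: closed_eq].
Qed.

Lemma infomxE (R : realType) (d K : nat) (x : 'I_K -> 'cV[R]_d) mu i j :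
  infomx x mu i j = \sum_k mu ord0 k * (x k i ord0 * x k j ord0).
Proof.
rewrite summxE; apply: eq_bigr => k _; rewrite !mxE; congr (_ * _).
by rewrite big_ord1 mxE.
Qed.

Lemma continuous_det_infomx (R : realType) (d K : nat) (x : 'I_K -> 'cV[R]_d) :
  continuous (fun mu => \det (infomx x mu)).
Proof.
have contZ (f : 'rV[R]_K -> R) c : continuous f -> continuous (fun mu => c * f mu).
  by move=> cf mu; apply: (@continuousM R _ (cst c) f); [exact: cst_continuous|exact: cf].
apply: continuous_big => [|s _]; first exact: add_continuous.
apply: (contZ); apply: continuous_big => [|i _]; first exact: mul_continuous.
under eq_fun do rewrite infomxE.
apply: continuous_big => [|k _]; first exact: add_continuous.
under eq_fun do rewrite mulrC.
by apply: (contZ); exact: coord_continuous.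
Qed.

Lemma infomx_tr (R : realType) (d K : nat) (x : 'I_K -> 'cV[R]_d) mu :
  (infomx x mu)^T = infomx x mu.
Proof. by rewrite linear_sum; apply: eq_bigr => i _; rewrite linearZ /= outer_tr. Qed.

Lemma dot_infomx (R : realType) (d K : nat) (x : 'I_K -> 'cV[R]_d) mu v :
  dot v (infomx x mu *m v) = \sum_k mu ord0 k * dot v (x k) ^+ 2.
Proof.
rewrite mulmx_suml dot_sumr; apply: eq_bigr => k _.
by rewrite -scalemxAl dotZr dot_outer [dot (x k) v]dotC -expr2.
Qed.

Lemma infomx_psd (R : realType) (d K : nat) (x : 'I_K -> 'cV[R]_d) mu :
  simplex mu -> psd (infomx x mu).
Proof.
move=> [mu01 _]; split=> [|v]; first exact: infomx_tr.
rewrite dot_infomx sumr_ge0 // => k _.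
by rewrite mulr_ge0 ?sqr_ge0 //; case/andP: (mu01 k).
Qed.

Lemma posdef_det_gt0 (R : realType) (d : nat) (M : 'M[R]_d) : posdef M -> 0 < \det M.
Proof.
move=> pM; have [C /(congr1 determinant)] := posdef_whitening pM.
rewrite !det_mulmx det_tr det1 mulrAC -expr2 => CM.
have C0 : 0 < \det C ^+ 2.
  rewrite lt0r sqr_ge0 andbT; apply/eqP => C0; move/eqP: CM.
  by rewrite C0 mul0r eq_sym oner_eq0.
by rewrite -(pmulr_rgt0 _ C0) CM.
Qed.

(** Matrix determinant lemma, by conjugation with a unipotent block matrix. *)
Lemma det_add_outer (R : comNzRingType) (d : nat) (u v : 'cV[R]_d) :
  \det (1%:M + u *m v^T) = 1 + (v^T *m u) ord0 ord0.
Proof.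
have E : block_mx 1%:M 0 v^T 1%:M *m block_mx (1%:M + u *m v^T) u 0 1%:M
           *m block_mx 1%:M 0 (- v^T) 1%:M
         = block_mx 1%:M u 0 (1%:M + v^T *m u).
  rewrite !mulmx_block !(mulmx0, mul0mx, mulmx1, mul1mx, addr0, add0r).
  rewrite !mulmxN addrK; congr block_mx.
    by rewrite mulmxDr mulmx1 mulmxDl mul1mx mulmxA [X in _ - X]addrC subrr.
  by rewrite addrC.
have := congr1 determinant E.
rewrite !det_mulmx !det_lblock !det_ublock !det1 !(mulr1, mul1r) => ->.
by rewrite det_mx11 !mxE eqxx.
Qed.

Lemma bernoulli_ineq (R : realType) (s : R) n : 0 <= s <= 1 ->
  1 - n%:R * s <= (1 - s) ^+ n.
Proof.
move=> /andP[s0 s1]; elim: n => [|n IH]; first by rewrite mul0r subr0 expr0.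
rewrite exprS; have s1' : 0 <= 1 - s by rewrite subr_ge0.
apply: le_trans (ler_wpM2l s1' IH); rewrite -natr1.
by have := mulr_ge0 (ler0n R n) (sqr_ge0 s); nra.
Qed.

Lemma infomx_mix (R : realType) (d K : nat) (x : 'I_K -> 'cV[R]_d) nu s k :
  infomx x ((1 - s) *: nu + s *: delta_mx ord0 k) =
  (1 - s) *: infomx x nu + s *: (x k *m (x k)^T).
Proof.
rewrite /infomx scaler_sumr -[s *: (x k *m _)]addr0.
under eq_bigr do rewrite !mxE scalerDl -!scalerA.
rewrite big_split /=; congr (_ + _).
rewrite (bigD1 k) //= !eqxx scale1r big1 // => i ik.
by rewrite (negPf ik) scale0r scaler0.
Qed.

Lemma simplex_mix (R : realType) (K : nat) (nu : 'rV[R]_K) s k :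
  simplex nu -> 0 <= s <= 1 -> simplex ((1 - s) *: nu + s *: delta_mx ord0 k).
Proof.
move=> [nu01 sum1] /andP[s0 s1].
have s1' : 0 <= 1 - s by rewrite subr_ge0.
have ge0 i : 0 <= ((1 - s) *: nu + s *: delta_mx ord0 k) ord0 i.
  have /andP[nu0 _] := nu01 i.
  by rewrite !mxE addr_ge0 // mulr_ge0.
have sumE : \sum_i ((1 - s) *: nu + s *: delta_mx ord0 k) ord0 i = 1.
  under eq_bigr do rewrite !mxE.
  rewrite big_split /= -!mulr_sumr sum1 mulr1 (bigD1 k) //= !eqxx big1 => [|i ik].
    by rewrite addr0 mulr1 subrK.
  by rewrite (negPf ik).
split=> // i; rewrite ge0 -[leRHS]sumE (bigD1 i) // lerDl sumr_ge0 //.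
Qed.

(* First-order optimality of a D-optimal design in the direction of a vertex of
   the simplex, by the matrix determinant lemma. *)
Lemma doptimal_dot_le (R : realType) (d K : nat) (x : 'I_K -> 'cV[R]_d) nu :
  (0 < d)%N -> simplex nu -> infomx x nu \in unitmx ->
  (forall eta, simplex eta -> \det (infomx x eta) <= \det (infomx x nu)) ->
  forall k, dot (x k) (invmx (infomx x nu) *m x k) <= d%:R.
Proof.
move=> d0 snu uM nuopt k; set M := infomx x nu; set q := dot _ _.
have M0 : 0 < \det M := posdef_det_gt0 (psd_posdef (infomx_psd x snu) uM).
have [//|qd] := leP q d%:R.
have d0' : 0 < d%:R :> R by rewrite ltr0n.
have q0 : 0 < q := lt_trans d0' qd.
(* Moving mass [s] to the vertex [k] multiplies the determinant by (1 - s)^d (1 + s q / (1 - s)),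
   which is at most 1 by optimality; Bernoulli's inequality linearizes the power. *)
have step s : 0 < s < 1 -> (1 - d%:R * s) * (1 + s / (1 - s) * q) <= 1.
  move=> /andP[s0 s1]; have s01 : 0 <= s <= 1 by rewrite !ltW.
  have s1' : 0 < 1 - s by rewrite subr_gt0.
  have := nuopt _ (simplex_mix k snu s01).
  rewrite infomx_mix -/M.
  have -> : (1 - s) *: M + s *: (x k *m (x k)^T) =
      M *m ((1 - s) *: (1%:M + (s / (1 - s)) *: (invmx M *m x k) *m (x k)^T)).
    rewrite -scalemxAr mulmxDr mulmx1 scalerDr; congr (_ + _).
    rewrite -scalemxAl -scalemxAr scalerA mulrCA divff ?gt_eqF // mulr1.
    by rewrite -mulmxA mulKVmx.
  rewrite det_mulmx detZ det_add_outer ger_pMr // -/(dot _ _) dotZr -/q => le1.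
  apply: le_trans (ler_wpM2r _ (bernoulli_ineq d s01)) le1.
  by rewrite addr_ge0 // mulr_ge0 ?ltW // divr_gt0.
(* Chosen so that d s q = (q - d) / 2: the left side of [step] is then at least 1 + s (q - d) / 2 >
   1. *)
pose s := (q - d%:R) / (2 * d%:R * q).
have dq0 : 0 < 2 * d%:R * q by rewrite !mulr_gt0.
have s0 : 0 < s by rewrite divr_gt0 // subr_gt0.
have ds : d%:R * s = (q - d%:R) / (2 * q) by rewrite /s; field; rewrite !gt_eqF.
have ds1 : d%:R * s < 2^-1.
  by rewrite ds ltr_pdivrMr ?mulr_gt0 // mulrA mulVf ?mul1r ?ltrBlDr ?ltrDl // gt_eqF.
have s1 : s <= d%:R * s by rewrite ler_peMl ?ler1n // ltW.
have s1' : 0 < 1 - s by lra.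
have := step s; rewrite s0 /= -subr_gt0 s1' => /(_ isT).
have : s <= s / (1 - s) by rewrite ler_pdivlMr // ler_piMr ?ltW // gtrBl.
set r := s / (1 - s) => sr.
have : (1 - d%:R * s) * (1 + s * q) <= (1 - d%:R * s) * (1 + r * q).
  by apply: ler_wpM2l; [lra|rewrite lerD2l ler_wpM2r // ltW].
have -> : (1 - d%:R * s) * (1 + s * q) = 1 + s * (q - d%:R - d%:R * s * q) by ring.
have -> : d%:R * s * q = (q - d%:R) / 2 by rewrite ds; field; rewrite gt_eqF.
have : 0 < s * (q - d%:R - (q - d%:R) / 2) by rewrite mulr_gt0 //; lra.
by move: (s * _) (_ * (1 + r * q)) => A B; lra.
Qed.

(** A D-optimal design exists by compactness and has leverages at most [d]; the largest leverage of
    a G-optimal design is no greater. *)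
Lemma goptimal_dot_le (R : realType) (d K : nat) (x : 'I_K -> 'cV[R]_d) mu :
  (0 < d)%N -> relaxed_optimal x (fG x) mu ->
  forall k, dot (x k) (invmx (infomx x mu) *m x k) <= d%:R.
Proof.
move=> d0 [smu uM mu_opt] k.
have [|nu /set_mem snu nu_max] := EVT_max_rV _ (@compact_simplex R K)
    (continuous_subspaceT (@continuous_det_infomx R d K x)).
  by exists mu.
have nuopt eta : simplex eta -> \det (infomx x eta) <= \det (infomx x nu).
  by move=> /mem_set; exact: nu_max.
have unu : infomx x nu \in unitmx.
  rewrite unitmxE unitfE gt_eqF // (lt_le_trans _ (nuopt _ smu)) //.
  exact: posdef_det_gt0 (psd_posdef (infomx_psd x smu) uM).
have le_nu := doptimal_dot_le d0 snu unu nuopt.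
have fGE (A : 'M[R]_d) i : ((x i)^T *m A *m x i) ord0 ord0 = dot (x i) (A *m x i).
  by rewrite -mulmxA.
apply: (@le_trans _ _ (fG x (invmx (infomx x mu)))).
  by rewrite -fGE; exact: (le_bigmax _ (fun i => ((x i)^T *m _ *m x i) ord0 ord0)).
apply: (le_trans (mu_opt _ snu unu)).
by apply: bigmax_le => // i _; rewrite fGE.
Qed.

(** * Criteria of inverses *)

Lemma enormE (R : realType) (d : nat) (v : 'cV[R]_d) : enorm v = Num.sqrt (dot v v).
Proof. by rewrite -sqr_enorm sqrtr_sqr ger0_norm ?enorm_ge0. Qed.

Lemma dot_le_enorm (R : realType) (d : nat) (u v : 'cV[R]_d) :
  dot u v <= enorm u * enorm v.
Proof.
rewrite !enormE -sqrtrM ?dot_ge0 // (le_trans (ler_norm _)) //.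
by rewrite -sqrtr_sqr ler_sqrt ?mulr_ge0 ?dot_ge0 // dot_cauchy.
Qed.

Lemma enormZ (R : realType) (d : nat) (a : R) (v : 'cV[R]_d) :
  enorm (a *: v) = `|a| * enorm v.
Proof. by rewrite !enormE dotZl dotZr mulrA -expr2 sqrtrM ?sqr_ge0 // sqrtr_sqr. Qed.

Lemma enorm0 (R : realType) (d : nat) : enorm (0 : 'cV[R]_d) = 0.
Proof. by rewrite enormE dot0r sqrtr0. Qed.

(** The Frobenius norm is an upper bound. This makes the [sup] in [opnorm] a genuine supremum. *)
Lemma opnorm_has_sup (R : realType) (d : nat) (A : 'M[R]_d) :
  has_sup [set enorm (A *m v) | v in [set v : 'cV[R]_d | enorm v <= 1]].
Proof.
split; first by exists (enorm (A *m 0)), 0 => //=; rewrite enorm0.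
pose F := \sum_i dot (row i A)^T (row i A)^T.
have F0 : 0 <= F by apply: sumr_ge0 => i _; exact: dot_ge0.
exists (Num.sqrt F) => _ [v /= v1 <-]; rewrite enormE ler_sqrt //.
have vv : dot v v <= 1 by rewrite -sqr_enorm expr_le1 ?enorm_ge0.
rewrite dotE ler_sum // => i _.
have -> : (A *m v) i ord0 = dot (row i A)^T v.
  by rewrite dotE mxE; apply: eq_bigr => j _; rewrite !mxE.
by rewrite -expr2 (le_trans (dot_cauchy _ _)) // ler_piMr ?dot_ge0.
Qed.

Lemma opnorm_ge0 (R : realType) (d : nat) (A : 'M[R]_d) : 0 <= opnorm A.
Proof.
apply: ub_le_sup; first by have [] := opnorm_has_sup A.
by exists 0 => /=; rewrite ?mulmx0 ?enorm0.
Qed.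

Lemma enorm_mulmx_le (R : realType) (d : nat) (A : 'M[R]_d) v :
  enorm (A *m v) <= opnorm A * enorm v.
Proof.
have [->|v0] := eqVneq v 0; first by rewrite mulmx0 enorm0 mulr0.
have nv : 0 < enorm v by rewrite enormE sqrtr_gt0 dot_gt0.
rewrite -ler_pdivrMr // mulrC -(ger0_norm (ltW nv)) -normfV -enormZ scalemxAr.
apply: ub_le_sup; first by have [] := opnorm_has_sup A.
exists ((enorm v)^-1 *: v) => //=.
by rewrite enormZ normfV (ger0_norm (ltW nv)) mulVf ?gt_eqF.
Qed.

Lemma opnorm_le (R : realType) (d : nat) (A : 'M[R]_d) (c : R) : 0 <= c ->
  (forall v, enorm (A *m v) <= c * enorm v) -> opnorm A <= c.
Proof.
move=> c0 Ac; apply: ge_sup; first by have [] := opnorm_has_sup A.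
by move=> _ [v /= v1 <-]; rewrite (le_trans (Ac v)) // ler_piMr.
Qed.

Lemma psd_dot_inv_cauchy (R : realType) (d : nat) (N : 'M[R]_d) u v :
  psd N -> N \in unitmx ->
  dot u v ^+ 2 <= dot u (N *m u) * dot v (invmx N *m v).
Proof.
move=> pN uN; have := psd_cauchy u (invmx N *m v) pN.
by rewrite mulKVmx // [dot (invmx N *m v) v]dotC.
Qed.

Lemma dot_inv_ge0 (R : realType) (d : nat) (N : 'M[R]_d) v :
  psd N -> N \in unitmx -> 0 <= dot v (invmx N *m v).
Proof. by move=> [_ N0] uN; have := N0 (invmx N *m v); rewrite mulKVmx // dotC. Qed.

Lemma dot_mul_le_opnorm (R : realType) (d : nat) (A : 'M[R]_d) v :
  dot v (A *m v) <= opnorm A * dot v v.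
Proof.
rewrite (le_trans (dot_le_enorm _ _)) // -sqr_enorm expr2 mulrCA ler_wpM2l ?enorm_ge0 //.
exact: enorm_mulmx_le.
Qed.

Lemma dot_le_opnorm_inv (R : realType) (d : nat) (N : 'M[R]_d) v :
  psd N -> N \in unitmx -> dot v v <= opnorm (invmx N) * dot v (N *m v).
Proof.
move=> pN uN; have [->|v0] := eqVneq v 0; first by rewrite mulmx0 !dot0r mulr0.
have vv : 0 < dot v v by rewrite dot_gt0.
have := psd_dot_inv_cauchy v v pN uN; rewrite expr2 => H.
rewrite -(ler_pM2r vv) (le_trans H) // mulrAC [leRHS]mulrC.
by rewrite ler_wpM2l ?dot_mul_le_opnorm //; case: pN.
Qed.

Section LoewnerInverse.
Variables (R : realType) (d : nat) (N S : 'M[R]_d) (c : R).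
Hypotheses (pN : psd N) (uN : N \in unitmx) (St : S^T = S) (c0 : 0 < c).
Hypothesis NS : forall v, c * dot v (N *m v) <= dot v (S *m v).

Lemma loewner_posdef : posdef S.
Proof.
split=> // v v0; rewrite (lt_le_trans _ (NS v)) // mulr_gt0 //.
exact: (psd_posdef pN uN).2.
Qed.

(** Cauchy-Schwarz gives (x^T S^-1 x)^2 <= (x^T S^-1 N S^-1 x) (x^T N^-1 x), and the first factor is
    at most x^T S^-1 x / c. *)
Lemma loewner_dot_inv x : dot x (invmx S *m x) <= c^-1 * dot x (invmx N *m x).
Proof.
have uS := posdef_unitmx loewner_posdef.
have xx := dot_inv_ge0 x (posdef_psd loewner_posdef) uS.
have := psd_dot_inv_cauchy (invmx S *m x) x pN uN.
rewrite [dot _ x]dotC; move: xx; rewrite le_eqVlt => /predU1P[<-|x0].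
  by rewrite mulr_ge0 ?invr_ge0 ?(ltW c0) // dot_inv_ge0.
move=> H; rewrite -(ler_pM2l x0) -expr2 (le_trans H) // mulrA ler_wpM2r ?dot_inv_ge0 //.
rewrite ler_pdivlMr // mulrC (le_trans (NS _)) // mulKVmx //.
by rewrite dotC.
Qed.

(** With u = S^-1 v, |u|^2 <= |N^-1| u^T N u <= |N^-1| u^T v / c, and u^T v <= |u| |v|. *)
Lemma loewner_opnorm_inv : opnorm (invmx S) <= c^-1 * opnorm (invmx N).
Proof.
have uS := posdef_unitmx loewner_posdef.
have k0 : 0 <= c^-1 * opnorm (invmx N) by rewrite mulr_ge0 ?opnorm_ge0 // invr_ge0 ltW.
apply: opnorm_le => // v; set u := invmx S *m v.
have [->|u0] := eqVneq u 0; first by rewrite enorm0 mulr_ge0 ?enorm_ge0.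
have nu : 0 < enorm u by rewrite enormE sqrtr_gt0 dot_gt0.
rewrite -(ler_pM2l nu) -expr2 sqr_enorm mulrCA.
apply: (le_trans (dot_le_opnorm_inv u pN uN)).
have := dot_le_enorm u v.
have := NS u; rewrite {2}/u mulKVmx // => NSu uv.
rewrite [c^-1 * _]mulrC -mulrA ler_wpM2l ?opnorm_ge0 //.
by rewrite ler_pdivlMl // (le_trans NSu).
Qed.

Lemma crit_inv_fE_le (a : R) : c^-1 <= a ->
  (crit_inv (@fE R d) S <= (a * fE (invmx N))%:E)%E.
Proof.
move=> ca; rewrite /crit_inv (posdef_unitmx loewner_posdef) lee_fin.
by rewrite (le_trans loewner_opnorm_inv) // ler_wpM2r ?opnorm_ge0.
Qed.

Lemma crit_inv_fG_le (K : nat) (x : 'I_K -> 'cV[R]_d) (a : R) : c^-1 <= a ->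
  (crit_inv (fG x) S <= (a * fG x (invmx N))%:E)%E.
Proof.
move=> ca; rewrite /crit_inv (posdef_unitmx loewner_posdef) lee_fin.
have ci0 : 0 < c^-1 by rewrite invr_gt0.
have a0 : 0 <= a by rewrite ltW // (lt_le_trans ci0).
have fG0 : 0 <= fG x (invmx N) by exact: bigmax_ge_id.
apply: bigmax_le => [|k _]; first by rewrite mulr_ge0.
rewrite -mulmxA -/(dot _ _) (le_trans (loewner_dot_inv _)) //.
apply: ler_pM => //; [exact: ltW|exact: dot_inv_ge0|].
rewrite /dot mulmxA.
exact: (le_bigmax _ (fun i => ((x i)^T *m _ *m x i) ord0 ord0)).
Qed.
End LoewnerInverse.

(** * Leverages of a design *)

Lemma dot_le_maxsqnorm (R : realType) (d K : nat) (x : 'I_K -> 'cV[R]_d) k :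
  dot (x k) (x k) <= maxsqnorm x.
Proof. by rewrite -sqr_enorm; exact: (le_bigmax _ (fun k => enorm (x k) ^+ 2)). Qed.

Section Design.
Variables (R : realType) (d K : nat) (x : 'I_K -> 'cV[R]_d) (mu : 'rV[R]_K).
Hypotheses (smu : simplex mu) (uM : infomx x mu \in unitmx).

Let mu0 k : 0 <= mu ord0 k. Proof. by case: smu => mu01 _; case/andP: (mu01 k). Qed.
Let pM := infomx_psd x smu.

Let q k := dot (x k) (invmx (infomx x mu) *m x k).

Lemma sum_leverage : \sum_k mu ord0 k * q k = d%:R.
Proof.
rewrite -(mxtrace1 R d) -(mulVmx uM) mulmx_sumr raddf_sum; apply: eq_bigr => k _ /=.
by rewrite -scalemxAr mxtraceZ mxtrace_mul_outer.
Qed.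

Lemma leverage_le k : q k <= maxsqnorm x * opnorm (invmx (infomx x mu)).
Proof.
rewrite (le_trans (dot_mul_le_opnorm _ _)) // mulrC ler_wpM2r ?opnorm_ge0 //.
exact: dot_le_maxsqnorm.
Qed.

Lemma dim_le_maxsqnorm_opnorm :
  d%:R <= maxsqnorm x * opnorm (invmx (infomx x mu)).
Proof.
rewrite -sum_leverage -[leRHS]mul1r -[X in X * _]smu.2 mulr_suml ler_sum // => k _.
by rewrite ler_wpM2l // leverage_le.
Qed.

(** The leverage q_k is the form of M at M^-1 x_k, hence the sum over j of mu_j (x_j^T M^-1 x_k)^2,
    whose term j = k is mu_k q_k^2. *)
Lemma weight_leverage_le1 k : mu ord0 k * q k <= 1.
Proof.
have q0 : 0 <= q k := dot_inv_ge0 (x k) pM uM.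
have := dot_infomx x mu (invmx (infomx x mu) *m x k).
rewrite mulKVmx // dotC -/(q k) (bigD1 k) //= [dot _ (x k)]dotC -/(q k) => qE.
move: q0; rewrite le_eqVlt => /predU1P[<-|q0]; first by rewrite mulr0.
rewrite -(ler_pM2r q0) mul1r -mulrA -expr2 [leRHS]qE lerDl sumr_ge0 // => j _.
by rewrite mulr_ge0 ?sqr_ge0.
Qed.

Hypothesis qd : forall k, q k <= d%:R.

(** Complementary slackness: the gaps d - q_k are nonnegative with mean 0 under [mu]. *)
Lemma weight_leverage k : mu ord0 k * q k = mu ord0 k * d%:R.
Proof.
have : \sum_k mu ord0 k * (d%:R - q k) = 0.
  under eq_bigr do rewrite mulrBr.
  by rewrite sumrB sum_leverage -mulr_suml smu.2 mul1r subrr.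
move/eqP; rewrite psumr_eq0 => [|i _]; last by rewrite mulr_ge0 ?subr_ge0.
move=> /allP /(_ k (mem_index_enum _)); rewrite /= mulrBr subr_eq0 eq_sym.
by move/eqP.
Qed.

(** Each mu_k d = mu_k q_k is at most 1, so the sum of the mu_k^2 is at most 1 / d. *)
Lemma sum_weight_compl : (0 < d)%N ->
  1 - d%:R^-1 <= \sum_k mu ord0 k * (1 - mu ord0 k).
Proof.
move=> d0; under eq_bigr do rewrite mulrBr mulr1.
rewrite sumrB smu.2 lerD2l lerN2 -[leRHS]mul1r -[X in X / _]smu.2 mulr_suml.
apply: ler_sum => k _; rewrite ler_wpM2l //.
rewrite -[leRHS]mul1r ler_pdivlMr ?ltr0n //.
by rewrite -weight_leverage weight_leverage_le1.
Qed.
End Design.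

(** * Draws *)

Lemma measure_bigsetU_le (R : realType) (disp : measure_display)
    (T : measurableType disp) (P : {measure set T -> \bar R}) (I : Type)
    (r : seq I) (B : pred I) (F : I -> set T) :
  (forall i, B i -> measurable (F i)) ->
  (P (\big[setU/set0]_(i <- r | B i) F i) <= \sum_(i <- r | B i) P (F i))%E.
Proof.
move=> mF.
suff : measurable (\big[setU/set0]_(i <- r | B i) F i) /\
  (P (\big[setU/set0]_(i <- r | B i) F i) <= \sum_(i <- r | B i) P (F i))%E by case.
elim/big_rec2: _ => [|i s A Bi [mA le_s]].
  by rewrite measure0; split.
split; first by apply: measurableU => //; exact: mF.
by rewrite (le_trans (measureU2 _ (mF _ Bi) mA)) // leeD2l.
Qed.

Section Draws.
Variables (R : realType) (d K : nat) (x : 'I_K -> 'cV[R]_d) (mu : 'rV[R]_K).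

Let Y k := x k *m (x k)^T.

(* The draws are independent only as matrices, and x k *m (x k)^T need not
   determine k: the mass of mu is moved to one index per matrix. *)
Definition repr_idx (k : 'I_K) : 'I_K := odflt k [pick j | Y j == Y k].

Definition repr_weight (j : 'I_K) : R := \sum_(k | repr_idx k == j) mu ord0 k.

Lemma repr_idxE k : Y (repr_idx k) = Y k.
Proof. by rewrite /repr_idx; case: pickP => [j /eqP|_]. Qed.

Lemma repr_idx_eq j k : Y j = Y k -> repr_idx j = repr_idx k.
Proof.
move=> jk; rewrite /repr_idx (eq_pick (Q := fun i => Y i == Y k)) => [|i].
  by case: pickP => //= /(_ k); rewrite eqxx.
by rewrite jk.
Qed.

Lemma repr_weight_neq0 j :
  repr_weight j != 0 -> exists2 k, mu ord0 k != 0 & Y k = Y j.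
Proof.
move=> pj; have [k /andP[/eqP kj k0]] : exists k, (repr_idx k == j) && (mu ord0 k != 0).
  apply/existsP; apply: contraNT pj => /existsPn none; apply/eqP.
  apply: big1 => k kj; have := none k; rewrite kj /= negbK => /eqP //.
by exists k => //; rewrite -kj repr_idxE.
Qed.

Hypothesis smu : simplex mu.

Lemma repr_weight_ge0 j : 0 <= repr_weight j.
Proof. by apply: sumr_ge0 => k _; case: smu => mu01 _; case/andP: (mu01 k). Qed.

Lemma sum_repr_weight : \sum_j repr_weight j = 1.
Proof. by rewrite -smu.2 [RHS](partition_big repr_idx xpredT). Qed.

Lemma sum_repr_weight_outer : \sum_j repr_weight j *: Y j = infomx x mu.
Proof.
rewrite [RHS](partition_big repr_idx xpredT) //; apply: eq_bigr => j _.
by rewrite scaler_suml; apply: eq_bigr => k /eqP <-; rewrite repr_idxE.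
Qed.

Variables (disp : measure_display) (T : measurableType disp) (P : probability T R).

(** If [j] does not represent its own class, [A] is empty and the weight of [j] is 0. *)
Lemma drawn_from_repr (W : T -> 'M[R]_d) (k : T -> 'I_K) j :
  (forall A : set 'I_K, measurable (k @^-1` A)) ->
  (forall j : 'I_K, P (k @^-1` [set j]) = (mu ord0 j)%:E) ->
  (forall w : T, W w = Y (k w)) ->
  let A := [set Z | Z = Y j /\ repr_idx j = j] in
  [/\ W @^-1` A = k @^-1` [set i | repr_idx i = j] & P (W @^-1` A) = (repr_weight j)%:E].
Proof.
move=> mk Pk Wk A.
have WA : W @^-1` A = k @^-1` [set i | repr_idx i = j].
  rewrite /A; apply/seteqP; split=> w /=; rewrite Wk.
    by move=> [Ykj jj]; rewrite (repr_idx_eq Ykj).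
  by move=> <-; split; rewrite ?repr_idxE //; apply: repr_idx_eq; exact: repr_idxE.
split=> //; rewrite WA.
have -> : k @^-1` [set i | repr_idx i = j] =
    \big[setU/set0]_(i < K | repr_idx i == j) k @^-1` [set i].
  rewrite -bigcup_seq_cond; apply/seteqP; split=> w /=.
    by move=> /eqP kj; exists (k w) => //=; rewrite mem_index_enum.
  by move=> [i /= /andP[_ /eqP <-] <-].
rewrite measure_bigsetU_ord => [|i|]; last 2 first.
- exact: mk.
- by move=> i i' _ _ [w [/= <- <-]].
by rewrite -sumEFin; apply: eq_bigr => i _; exact: Pk.
Qed.

(** The bad event is the union, over bad index tuples [t], of the events [E t] that the draws follow
    [t]. Independence gives each a product probability, and the union bound suffices. *)
Lemma iid_draws_prob_ge n (W : 'I_n -> T -> 'M[R]_d) (G : set 'M[R]_d) :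
  iid_draws x mu P W ->
  ((1 - \sum_(t : n.-tuple 'I_K | `[< ~ G (\sum_(i < n) Y (tnth t i)) >])
         \prod_(i < n) repr_weight (tnth t i))%:E <=
   P [set w | G (\sum_(i < n) W i w)%R])%E.
Proof.
move=> [Wmu indep].
have [k kP] := choice Wmu.
pose A j : set 'M[R]_d := [set Z | Z = Y j /\ repr_idx j = j].
pose E (t : n.-tuple 'I_K) : set T :=
  \bigcap_(i in [set` [set: 'I_n]%SET]) (W i @^-1` A (tnth t i)).
have WA i j : W i @^-1` A j = k i @^-1` [set h | repr_idx h = j] /\
    P (W i @^-1` A j) = (repr_weight j)%:E.
  by have [mk Pk Wk] := kP i; exact: (drawn_from_repr j mk Pk Wk).
have mE t : measurable (E t).
  apply: fin_bigcap_measurable => // i _; rewrite (WA i _).1.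
  by have [mk _ _] := kP i; exact: mk.
have PE t : P (E t) = (\prod_(i < n) repr_weight (tnth t i))%:E.
  rewrite [LHS](indep [set: 'I_n]%SET (fun i => A (tnth t i))).
  rewrite -prodEFin; apply: eq_big => [i|i _]; first by rewrite inE.
  by rewrite (WA i _).2.
pose B := \big[setU/set0]_(t : n.-tuple 'I_K |
            `[< ~ G (\sum_(i < n) Y (tnth t i)) >]) E t.
have mB : measurable B by apply: bigsetU_measurable.
(* This identity also makes the event measurable, for every [G]. *)
have -> : [set w | G (\sum_(i < n) W i w)] = ~` B.
  rewrite /B -bigcup_seq_cond; apply/seteqP; split=> w /=.
    move=> Gw [t /= /andP[_ /asboolP nG] Etw]; apply: nG.
    have <- // : \sum_(i < n) W i w = \sum_(i < n) Y (tnth t i).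
    by apply: eq_bigr => i _; have [|-> _] := Etw i; rewrite /= ?inE.
  move=> nB; apply: contrapT => nG; apply: nB.
  exists [tuple repr_idx (k i w) | i < n] => /=.
    rewrite mem_index_enum; apply/asboolP => G1; apply: nG.
    under eq_bigr => i _ do have [_ _ ->] := kP i.
    by move: G1; under eq_bigr => i _ do rewrite tnth_mktuple repr_idxE.
  move=> i _ /=; rewrite tnth_mktuple; have [_ _ ->] := kP i.
  split; first by rewrite repr_idxE.
  by apply: repr_idx_eq; exact: repr_idxE.
rewrite probability_setC // EFinB leeB //.
rewrite (le_trans (measure_bigsetU_le _ _ _)) //.
by rewrite -sumEFin; apply: lee_sum => t _; rewrite -PE.
Qed.
End Draws.

(** * Concentration of the sample matrix *)

Lemma ln_dim_gt0 (R : realType) (d : nat) (delta : R) :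
  (0 < d)%N -> 0 < delta < 1 -> 0 < ln (d%:R / delta).
Proof.
move=> d0 /andP[delta0 delta1]; rewrite ln_gt0 // ltr_pdivlMr // mul1r.
by rewrite (lt_le_trans delta1) // ler1n.
Qed.

Section DesignConcentration.
Variables (R : realType) (d K : nat) (x : 'I_K -> 'cV[R]_d) (mu : 'rV[R]_K).
Hypotheses (d0 : (0 < d)%N) (smu : simplex mu) (uM : infomx x mu \in unitmx).

Lemma psd_scale_infomx n : psd (n%:R *: infomx x mu).
Proof.
have [Mt M0] := infomx_psd x smu; split=> [|v]; first by rewrite linearZ /= Mt.
by rewrite -scalemxAl dotZr mulr_ge0.
Qed.

Lemma unitmx_scale_infomx n : (0 < n)%N -> n%:R *: infomx x mu \in unitmx.
Proof. by move=> n0; rewrite unitmxZ // unitfE pnatr_eq0 -lt0n. Qed.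

(** For e = sqrt (c / n), the Chernoff bound d exp (- e^2 n / (2 l)) equals [delta]. The property
    [G], implied by S >= (1 - e) n M, will be a bound on a criterion. *)
Lemma design_chernoff (l delta : R) (n : nat) (disp : measure_display)
    (T : measurableType disp) (P : probability T R) (W : 'I_n -> T -> 'M[R]_d)
    (G : set 'M[R]_d) :
  let c := 2 * l * ln (d%:R / delta) in
  0 < l -> (forall k, dot (x k) (invmx (infomx x mu) *m x k) <= l) ->
  0 < delta < 1 -> c < n%:R ->
  (forall S : 'M[R]_d, S^T = S ->
    (forall v, (1 - Num.sqrt (c / n%:R)) * dot v ((n%:R *: infomx x mu) *m v) <=
               dot v (S *m v)) -> G S) ->
  iid_draws x mu P W ->
  ((1 - delta)%:E <= P [set w | G (\sum_(i < n) W i w)%R])%E.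
Proof.
move=> c l0 ql delta01 cn GS Wmu.
have ln0 := ln_dim_gt0 d0 delta01.
have /andP[delta0 _] := delta01.
have c0 : 0 < c by rewrite !mulr_gt0.
have n0 : 0 < n%:R :> R := lt_trans c0 cn.
apply: le_trans (iid_draws_prob_ge G Wmu).
rewrite lee_fin lerD2l lerN2.
pose e := Num.sqrt (c / n%:R).
have cn0 : 0 < c / n%:R by rewrite divr_gt0.
have e01 : 0 < e < 1.
  rewrite sqrtr_gt0 cn0 /= -[ltRHS]sqrtr1 ltr_sqrt // ltr_pdivrMr // mul1r //.
have := @matrix_chernoff R d _ (repr_weight x mu) x l e n d0
  (repr_weight_ge0 x smu) (sum_repr_weight x smu).
rewrite sum_repr_weight_outer => /(_ uM l0 ql e01) H.
have <- : d%:R * expR (- (e ^+ 2 * n%:R / (2 * l))) = delta.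
  have -> : - (e ^+ 2 * n%:R / (2 * l)) = - ln (d%:R / delta).
    by rewrite sqr_sqrtr ?(ltW cn0) // /c; field; rewrite !gt_eqF.
  have d0' : 0 < d%:R :> R by rewrite ltr0n.
  by rewrite expRN lnK ?posrE ?divr_gt0 // invf_div mulrC divfK // gt_eqF.
apply: le_trans H; rewrite [leLHS]big_mkcond [leRHS]big_mkcond ler_sum // => t _.
case: asboolP => [nG|_]; last first.
  by case: ifP => // _; apply: prodr_ge0 => i _; exact: repr_weight_ge0.
rewrite ifT //; apply/asboolP; apply: contrapT => none; apply: nG; apply: GS.
  by rewrite linear_sum; apply: eq_bigr => i _; exact: outer_tr.
move=> v; rewrite leNgt; apply/negP => vS; apply: none; exists v.
by move: vS; rewrite -scalemxAl dotZr mulrA.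
Qed.

End DesignConcentration.

(** * Deviation factors *)

Lemma inv_compl_sqrt (R : realType) (c n : R) : 0 < c -> c < n ->
  (1 - Num.sqrt (c / n))^-1 = 1 + 1 / (Num.sqrt (n / c) - 1).
Proof.
move=> c0 cn; have n0 := lt_trans c0 cn.
have -> : n / c = (c / n)^-1 by rewrite invf_div.
rewrite sqrtrV ?divr_ge0 ?ltW //; set e := Num.sqrt _.
have e0 : 0 < e by rewrite sqrtr_gt0 divr_gt0.
have e1 : e < 1.
  by rewrite -[ltRHS]sqrtr1 ltr_sqrt // ltr_pdivrMr // mul1r.
have e1n : 0 < 1 - e by rewrite subr_gt0.
by field; rewrite mulN1r !gt_eqF.
Qed.

(** (1 - e) (1 + e + 2 e^2) = 1 + e^2 (1 - 2 e). The remainder 2 e^2 will be the sequence r_n. *)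
Lemma inv_compl_le (R : realType) (e : R) : 0 <= e -> 2 * e <= 1 ->
  (1 - e)^-1 <= 1 + e + 2 * e ^+ 2.
Proof.
move=> e0 e2; have e1 : 0 < 1 - e by lra.
rewrite -[leLHS]mul1r ler_pdivrMr //.
have : 0 <= e ^+ 2 * (1 - 2 * e) by rewrite mulr_ge0 ?sqr_ge0 //; lra.
by lra.
Qed.

Lemma inv_littleo_inv_sqrt (R : realType) (a : R) :
  (fun n : nat => a / n%:R) =o_\oo (fun n : nat => 1 / Num.sqrt n%:R).
Proof.
apply/eqoP => e e0.
exists (Num.truncn ((a / e) ^+ 2)).+1 => // n /= nN.
have sn : `|a / e| <= Num.sqrt n%:R.
  rewrite -sqrtr_sqr ler_sqrt // ltW // (lt_le_trans (truncnS_gt _)) //.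
  by rewrite ler_nat.
have n0 : 0 < Num.sqrt n%:R :> R by rewrite sqrtr_gt0 ltr0n (leq_trans _ nN).
rewrite mul1r normrM !normfV [`|n%:R|]ger0_norm // [`|Num.sqrt _|]gtr0_norm //.
rewrite -[X in _ / X](@sqr_sqrtr R) // ler_pdivrMr ?exprn_gt0 //.
rewrite expr2 mulrA divfK ?gt_eqF //.
by move: sn; rewrite normrM normfV (gtr0_norm e0) ler_pdivrMr // mulrC.
Qed.

Section GOptimal.
Variables (R : realType) (d K : nat) (x : 'I_K -> 'cV[R]_d) (mu : 'rV[R]_K).
Hypotheses (d0 : (0 < d)%N) (mu_opt : relaxed_optimal x (fG x) mu).

Let L := maxsqnorm x.
Let k0 := opnorm (invmx (infomx x mu)).
Let V := \sum_k mu ord0 k * (1 - mu ord0 k).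

(** Squared and divided by 2 lg / n, the claim reads d <= (L k0)^4 V / d^2. It follows from L k0 >=
    d and d V >= d - 1 >= 1, which is where d >= 2 enters. *)
Lemma goptimal_slack (lg n : R) : (1 < d)%N -> 0 < lg -> 0 < n ->
  Num.sqrt (2 * d%:R * lg / n) <=
  L / d%:R * k0 ^+ 2 * Num.sqrt (2 * (L ^+ 2 * V) / n * lg).
Proof.
move=> d2 lg0 n0; have [smu uM _] := mu_opt.
have dL : d%:R <= L * k0 := dim_le_maxsqnorm_opnorm smu uM.
have Vd : 1 - d%:R^-1 <= V := sum_weight_compl smu uM (goptimal_dot_le d0 mu_opt) d0.
have d0' : 0 < d%:R :> R by rewrite ltr0n.
have L0 : 0 <= L by exact: bigmax_ge_id.
have kk0 : 0 <= k0 := opnorm_ge0 _.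
have dV : 1 <= d%:R * V.
  apply: le_trans (ler_wpM2l (ltW d0') Vd).
  by rewrite mulrBr mulr1 divff ?gt_eqF // lerBrDr (ler_nat _ 2).
have a0 : 0 <= L / d%:R * k0 ^+ 2 by rewrite !mulr_ge0 ?exprn_ge0 // invr_ge0 ltW.
rewrite -[X in X * Num.sqrt _](ger0_norm a0) -sqrtr_sqr -sqrtrM ?sqr_ge0 //.
have V0 : 0 <= V by rewrite -(pmulr_rge0 _ d0') (le_trans ler01).
rewrite ler_sqrt; last first.
  rewrite !(sqr_ge0, mulr_ge0) // ?invr_ge0 ?(ltW n0) ?(ltW lg0) //.
have -> : (L / d%:R * k0 ^+ 2) ^+ 2 * (2 * (L ^+ 2 * V) / n * lg) =
   2 * lg / n * ((L * k0) ^+ 4 / d%:R ^+ 2 * V) by field; rewrite !gt_eqF.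
have -> : 2 * d%:R * lg / n = 2 * lg / n * d%:R by ring.
rewrite ler_wpM2l ?divr_ge0 ?mulr_ge0 ?(ltW lg0) ?(ltW n0) //.
rewrite mulrAC ler_pdivlMr ?exprn_gt0 //.
apply: (@le_trans _ _ (d%:R ^+ 4 * V)).
  have -> : d%:R ^+ 4 * V = d%:R ^+ 3 * (d%:R * V) by ring.
  by rewrite -exprS ler_peMr // exprn_ge0 // ltW.
by rewrite ler_wpM2r // lerXn2r // nnegrE ?mulr_ge0 // ltW.
Qed.
End GOptimal.

(** In dimension 1, M^-1 x_k x_k^T is the scalar q_k, equal to d = 1 on the support. *)
Lemma goptimal_dim1_outer (R : realType) (K : nat) (x : 'I_K -> 'cV[R]_1) mu k :
  relaxed_optimal x (fG x) mu -> mu ord0 k != 0 ->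
  x k *m (x k)^T = infomx x mu.
Proof.
move=> mu_opt mk; have [smu uM _] := mu_opt.
have := weight_leverage smu uM (goptimal_dot_le (ltn0Sn 0) mu_opt) k.
move/(mulfI mk); rewrite -mxtrace_mul_outer [invmx _ *m _]mx11_scalar mxtrace_scalar.
move=> q1; rewrite -[LHS](mulKVmx uM) [invmx _ *m _]mx11_scalar.
by move: q1; rewrite mulr1n => ->; rewrite mulmx1.
Qed.

Theorem theorem3p1 (R : realType) (d K : nat) (x : 'I_K -> 'cV[R]_d)
    (delta : R) (hd : (0 < d)%N)
    (hspan : (<< [seq x k | k : 'I_K] >> = fullv)%VS)
    (hdelta : 0 < delta < 1) :
  let L := maxsqnorm x in
  (forall (mu : 'rV[R]_K) (n : nat)
      (disp : measure_display) (T : measurableType disp)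
      (P : probability T R) (W : 'I_n -> T -> 'M[R]_d),
    let Minv := invmx (infomx x mu) in
    relaxed_optimal x (@fE R d) mu ->
    (0 < n)%N ->
    n%:R > 2 * L * opnorm Minv * ln (d%:R / delta) ->
    iid_draws x mu P W ->
    ((1 - delta)%:E <=
      P [set w | crit_inv (@fE R d) (\sum_(i < n) W i w) <=
        ((1 + 1 / (Num.sqrt
              (n%:R / (2 * L * opnorm Minv * ln (d%:R / delta))) - 1))
          * fE (invmx (n%:R *: infomx x mu)))%:E])%E)
  /\
  (forall mu : 'rV[R]_K,
    let Minv := invmx (infomx x mu) in
    let sigma2 := L ^+ 2 * \sum_(k < K) mu ord0 k * (1 - mu ord0 k) in
    relaxed_optimal x (fG x) mu ->
    exists r : nat -> R,
      r =o_\oo (fun n : nat => 1 / Num.sqrt n%:R) /\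
      \forall n \near \oo,
        forall (disp : measure_display) (T : measurableType disp)
          (P : probability T R) (W : 'I_n -> T -> 'M[R]_d),
        iid_draws x mu P W ->
        ((1 - 2 * delta)%:E <=
          P [set w | crit_inv (fG x) (\sum_(i < n) W i w) <=
            ((1 + L / d%:R * opnorm Minv ^+ 2
                  * Num.sqrt (2 * sigma2 / n%:R * ln (d%:R / delta))
                + r n)
              * fG x (invmx (n%:R *: infomx x mu)))%:E])%E).
Proof.
move=> L; have lnd := ln_dim_gt0 hd hdelta.
have d0' : 0 < d%:R :> R by rewrite ltr0n.
split=> [mu n disp T P W Minv [smu uM _] n0 nbig Wmu|mu Minv sigma2 mu_opt].
  have Lk : 0 < L * opnorm Minv := lt_le_trans d0' (dim_le_maxsqnorm_opnorm smu uM).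
  rewrite -[2 * L * _]mulrA in nbig *.
  set c := 2 * _ * _ in nbig *.
  have c0 : 0 < c by rewrite mulr_gt0 ?(mulr_gt0 _ Lk).
  set b := (_ * fE _)%:E.
  apply: (design_chernoff (G := [set S | (crit_inv (@fE R d) S <= b)%E])
    hd smu uM Lk (leverage_le x mu) hdelta nbig) => // S St SN.
  rewrite /= /b; apply: (crit_inv_fE_le (psd_scale_infomx x smu n)
    (unitmx_scale_infomx uM n0) St _ SN).
    rewrite subr_gt0 -[ltRHS]sqrtr1 ltr_sqrt // ltr_pdivrMr ?mul1r //.
    exact: lt_trans nbig.
  by rewrite inv_compl_sqrt.
have [smu uM _] := mu_opt; have /andP[delta0 _] := hdelta.
pose c := 2 * d%:R * ln (d%:R / delta).
have c0 : 0 < c by rewrite !mulr_gt0.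
(* The remainder 2 e^2 of [inv_compl_le] for e^2 = c / n. *)
exists (fun n => 2 * c / n%:R); split; first exact: inv_littleo_inv_sqrt.
(* Beyond 4 c one has 2 e <= 1. *)
exists (Num.truncn (4 * c)).+1 => // n /= nN disp T P W Wmu.
have cn : 4 * c < n%:R by rewrite (lt_le_trans (truncnS_gt _)) // ler_nat.
have n0 : (0 < n)%N by rewrite (leq_trans _ nN).
have n0' : 0 < n%:R :> R by rewrite ltr0n.
set eta := L / d%:R * _ * _; set b := (_ * fG _ _)%:E.
have eta0 : 0 <= eta.
  rewrite !mulr_ge0 ?exprn_ge0 ?opnorm_ge0 ?invr_ge0 ?sqrtr_ge0 //.
  exact: bigmax_ge_id.
have r0 : 0 <= 2 * c / n%:R by rewrite divr_ge0 ?mulr_ge0 ?ltW.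
apply: (@le_trans _ _ (1 - delta)%:E).
  by rewrite lee_fin lerD2l lerN2 ler_peMl ?(ltW delta0) // ler1n.
have [d1|d2] := leqP d 1; last first.
  have cn1 : c < n%:R by move: cn c0; lra.
  apply: (design_chernoff (G := [set S | (crit_inv (fG x) S <= b)%E])
    hd smu uM d0' (goptimal_dot_le hd mu_opt) hdelta cn1) => // S St SN.
  set e := Num.sqrt _ in SN.
  have ee : e ^+ 2 = c / n%:R by rewrite sqr_sqrtr // divr_ge0 ?ltW.
  have e0 : 0 <= e by exact: sqrtr_ge0.
  have e2 : 2 * e <= 1.
    rewrite -(@expr_le1 _ 2) ?mulr_ge0 // exprMn ee mulrA ler_pdivrMr // mul1r.
    by move: cn; lra.
  rewrite /= /b; apply: (crit_inv_fG_le (psd_scale_infomx x smu n)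
    (unitmx_scale_infomx uM n0) St _ SN).
    by move: e2; lra.
  apply: (le_trans (inv_compl_le e0 e2)); rewrite ee mulrA lerD2r lerD2l.
  exact: (goptimal_slack hd mu_opt).
have d1E : d = 1%N by apply/eqP; rewrite eqn_leq d1.
subst d.
(* For d = 1, all draws of a tuple of nonzero weight equal M, so the sum is n M: bad tuples have
   weight 0. *)
apply: le_trans (iid_draws_prob_ge [set S | (crit_inv (fG x) S <= b)%E] Wmu).
rewrite lee_fin lerD2l lerN2 big1 ?(ltW delta0) // => t /asboolP bad.
apply/eqP; apply: contra_notT bad => w0.
have -> : \sum_(i < n) x (tnth t i) *m (x (tnth t i))^T = n%:R *: infomx x mu.
  rewrite scaler_nat -[X in _ *+ X]card_ord -sumr_const; apply: eq_bigr => i _.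
  have [|k mk <-] := @repr_weight_neq0 _ _ _ x mu (tnth t i).
    by move/prodf_neq0: w0 => /(_ i isT).
  exact: goptimal_dim1_outer.
have pN := psd_scale_infomx x smu n.
rewrite /= /b; apply: (crit_inv_fG_le pN (unitmx_scale_infomx uM n0) pN.1 ltr01) => [v|].
  by rewrite mul1r.
by rewrite invr1 -addrA lerDl addr_ge0.
Qed.
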